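(* Let $\kappa,\lambda,\mu,\rho,\theta$ be cardinals with $\mathrm{cf}(\mu)>\omega$. Consider the following statements. (a) $\kappa\to(\mu)^2_{\lambda,<\rho}$: for every $f:[\kappa]^2\to\lambda$ there is $A\subseteq\kappa$ of order type $\mu$ such that $|f''[A]^2|<\rho$. (b) $\kappa\to(\mu\text{-}st)^2_{\lambda,<\rho}$: for every $f:[\kappa]^2\to\lambda$ there is $A\subseteq\kappa$ of order type $\mu$, stationary in $\sup A$, such that $|f''[A]^2|<\rho$. (c) $\mu\to^{\mathrm{poly}}(\theta)^2_{<\rho\text{-}t\text{-}bdd}$: for every normal $<\rho$-type bounded $f:[\mu]^2\to\mu$ there is an $f$-rainbow subset of $\mu$ of order type $\theta$. (d) $\mu\to^{\mathrm{poly}}(par(<\mathrm{cf}(\mu)))^2_{<\rho\text{-}t\text{-}bdd}$: for every normal $<\rho$-type bounded $f:[\mu]^2\to\mu$ there are an ordinal $\gamma<\mathrm{cf}(\mu)$ and a function $g:\mu\to\gamma$ such that $g^{-1}\{i\}$ is $f$-rainbow for every $i<\gamma$. Then: (1) (a) and (c) together imply $\kappa\to^{\mathrm{poly}}(\theta)^2_{<\lambda^+\text{-}t\text{-}bdd}$, i.e. for every normal $<\lambda^+$-type bounded $f:[\kappa]^2\to\kappa$ there is an $f$-rainbow subset of $\kappa$ of order type $\theta$; (2) (b) and (d) together imply $\kappa\to^{\mathrm{poly}}(\mu\text{-}st)^2_{<\lambda^+\text{-}t\text{-}bdd}$, i.e. for every normal $<\lambda^+$-type bounded $f:[\kappa]^2\to\kappa$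 there is an $f$-rainbow set $A\subseteq\kappa$ of order type $\mu$ which is stationary in $\sup A$.
   Context: $[C]^2$ is the set of two-element subsets of $C$. A coloring $f$ on $[C]^2$, $C$ a set of ordinals, is normal if $f(a)=f(b)$ implies $\max a=\max b$. A set $A\subseteq C$ is $f$-rainbow if $f\restriction[A]^2$ is one-to-one. For an ordinal $\alpha$, a coloring $f:[\kappa]^2\to\kappa$ is $<\alpha$-type bounded if there is an ordinal $\gamma<\alpha$ such that for all $\eta<\beta<\kappa$ the set $t_{\eta\beta}=\{\xi<\beta: f(\{\xi,\beta\})=f(\{\eta,\beta\})\}$ has order type at most $\gamma$. *)

(* Defs.v *)
From mathcomp Require Import all_boot.
From mathcomp Require Import boolp classical_sets functions cardinality wochoice.

Set Implicit Arguments.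
Unset Strict Implicit.
Unset Printing Implicit Defensive.

Local Open Scope classical_set_scope.
Local Open Scope card_scope.

(* An ordinal is a type with a (reflexive) well-order; its elements play the
   role of the smaller ordinals, and equality of ordinals is isomorphism. *)
Record Ord := MkOrd {
  carrier :> Type;
  wle : rel carrier;
  wle_wo : well_order wle }.

Definition wlt (a : Ord) (x y : a) : bool := ~~ wle y x.

Section OrdOrder.
Variable a : Ord.
Implicit Types (x y z : a) (P : a -> Prop).

Lemma wo_min P : (exists x, P x) -> exists2 x, P x & forall y, P y -> wle x y.
Proof.
move=> [x Px]; have [|z [[zP zmin] _]] := @wle_wo a [pred y | `[< P y >]].
  by exists x; apply/asboolP.
exists z; first by move: zP => /asboolP.
by move=> y Py; apply: zmin; apply/asboolP.
Qed.

Lemma wle_refl x : wle x x.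
Proof. by have [|y <- /(_ x)] := @wo_min (eq x); [exists x|apply]. Qed.

Lemma wle_total x y : wle x y || wle y x.
Proof.
have [|z [->|->] zmin] := @wo_min (fun z => z = x \/ z = y); first by exists x; left.
  by rewrite zmin //; right.
by rewrite orbC zmin //; left.
Qed.

Lemma wle_anti x y : wle x y -> wle y x -> x = y.
Proof.
move=> xy yx.
have [|z [_ zu]] := @wle_wo a [pred z | `[< z = x \/ z = y >]].
  by exists x; apply/asboolP; left.
have zx : z = x.
  by apply: zu; split; [apply/asboolP; left|move=> w /asboolP[]->//; exact: wle_refl].
have zy : z = y.
  by apply: zu; split; [apply/asboolP; right|move=> w /asboolP[]->//; exact: wle_refl].
by rewrite -zx -zy.
Qed.

Lemma wle_trans y x z : wle x y -> wle y z -> wle x z.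
Proof.
move=> xy yz.
have [|w + wmin] := @wo_min (fun w => [\/ w = x, w = y | w = z]).
  by exists x; constructor 1.
have wx : wle w x by apply: wmin; constructor 1.
have wy : wle w y by apply: wmin; constructor 2.
have wz : wle w z by apply: wmin; constructor 3.
case=> ?; subst w => //; first by rewrite (wle_anti xy wx).
by rewrite -(wle_anti yz wy).
Qed.

Lemma wltxx x : wlt x x = false.
Proof. by rewrite /wlt wle_refl. Qed.

Lemma wltW x y : wlt x y -> wle x y.
Proof. by rewrite /wlt; case/orP: (wle_total x y) => -> //. Qed.

Lemma wlt_trans y x z : wlt x y -> wlt y z -> wlt x z.
Proof.
by move=> /wltW xy; apply: contra => zx; apply: wle_trans xy.
Qed.

Lemma wlt_total x y : [\/ wlt x y, x = y | wlt y x].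
Proof.
have [yx|] := boolP (wle y x); last by constructor 1.
have [xy|] := boolP (wle x y); last by constructor 3.
by constructor 2; apply: wle_anti.
Qed.

End OrdOrder.

(* The initial segment below x; it stands for the ordinal x itself. *)
Definition seg (a : Ord) (x : a) : set a := [set y | wlt y x].

Lemma sub_wo (a : Ord) (A : set a) :
  well_order (fun x y : A => wle (val x) (val y)).
Proof.
apply: antisymmetric_well_order => [x y /andP[xy yx]|B [x Bx]].
  by apply: val_inj; apply: wle_anti.
have [|_ [y By <-] ymin] := @wo_min a (fun z => exists2 y : A, y \in B & val y = z).
  by exists (val x), x.
by exists y; split=> // z Bz; apply: ymin; exists z.
Qed.

Lemma nat_wo : well_order leq.
Proof.
apply: antisymmetric_well_order => [m n|A Ane]; first by rewrite -eqn_leq => /eqP.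
by have [m Am mmin] := ex_minnP (Ane : exists n, A n); exists m; split.
Qed.

Definition omega : Ord := MkOrd nat_wo.

Definition otp (a : Ord) (A : set a) : Ord := MkOrd (sub_wo (A := A)).

Definition in_otp (a : Ord) (A : set a) (x : a) (xA : x \in A) : otp A :=
  exist (fun y => is_true (y \in A)) x xA.

Lemma otp_inj (a : Ord) (A : set a) (u v : otp A) :
  val (u : A) = val (v : A) -> u = v.
Proof. exact: val_inj. Qed.

Definition oiso (a b : Ord) : Prop :=
  exists2 f : a -> b, bijective f & {mono f : x y / wle x y}.

Definition olt (a b : Ord) : Prop := exists x : b, oiso a (otp (seg x)).

Definition ole (a b : Ord) : Prop := olt a b \/ oiso a b.

Lemma oisoI (a b : Ord) (f : a -> b) :
  {mono f : x y / wle x y} -> (forall y, exists x, f x = y) -> oiso a b.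
Proof.
move=> fm fs; exists f => //; have [g fg] := choice fs.
exists g => // x; have fe := fg (f x).
by apply: wle_anti; rewrite -fm fe wle_refl.
Qed.

Lemma oiso_refl a : oiso a a.
Proof. by apply: (@oisoI _ _ id) => // y; exists y. Qed.

Lemma oiso_sym a b : oiso a b -> oiso b a.
Proof.
case=> f [g fg gf] fm; apply: (@oisoI _ _ g) => [x y|y]; last by exists (f y).
by rewrite -fm !gf.
Qed.

Lemma oiso_trans b a c : oiso a b -> oiso b c -> oiso a c.
Proof.
case=> f fb fm [g gb gm]; exists (g \o f); first exact: bij_comp.
by move=> x y /=; rewrite gm fm.
Qed.

(* f restricts to an isomorphism from seg x onto seg y *)
Definition seg_isom (a b : Ord) (x : a) (y : b) (f : a -> b) :=
  (forall u v, wlt u x -> wlt v x -> wlt (f u) (f v) = wlt u v) /\ f @` seg x = seg y.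

Lemma seg_isoP (a b : Ord) (x : a) (y : b) f :
  seg_isom x y f -> oiso (otp (seg x)) (otp (seg y)).
Proof.
move=> [fm fs].
have fP (u : seg x) : f (val u) \in seg y.
  by rewrite inE -fs; exists (val u) => //; apply: set_mem (valP u).
pose g (u : otp (seg x)) : otp (seg y) := in_otp (fP u).
apply: (@oisoI _ _ g).
  by move=> u v; apply: negb_inj; exact: fm (set_mem (valP v)) (set_mem (valP u)).
move=> [w wy]; have : (f @` seg x) w by rewrite fs; exact: set_mem wy.
move=> [u ux fuw]; have ux' : u \in seg x by exact: mem_set.
by exists (in_otp ux'); apply: otp_inj.
Qed.

Lemma seg_isom_sub (a b : Ord) (x u : a) (y : b) f : seg_isom x y f -> wlt u x -> seg_isom u (f u) f.
Proof.
move=> [fm fs] ux; split=> [v w vu wu|].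
  by apply: fm; exact: wlt_trans ux.
rewrite eqEsubset; split=> [_ [v vu <-]|w wfu].
  by rewrite /seg /= fm //; exact: wlt_trans ux.
have : seg y w.
  by apply: wlt_trans wfu _; suff: seg y (f u) by []; rewrite -fs; exists u.
rewrite -fs => -[v vx fvw]; exists v => //; rewrite /seg /= -fm //.
by rewrite fvw.
Qed.

Lemma seg_isom_uniq (a b : Ord) (x : a) (y y' : b) f f' :
  seg_isom x y f -> seg_isom x y' f' -> y = y'.
Proof.
move=> [fm fs] [fm' fs'].
have key (y1 y2 : b) g g' u : seg_isom x y1 g -> seg_isom x y2 g' -> wlt u x ->
    (forall v, wlt v u -> g v = g' v) -> ~ wlt (g u) (g' u).
  move=> [gm gs] [gm' gs'] ux ih guu.
  have : (g' @` seg x) (g u).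
    by rewrite gs'; apply: wlt_trans guu _; suff: seg y2 (g' u) by []; rewrite -gs'; exists u.
  move=> [v vx gv]; have vu : wlt v u by rewrite -(gm' _ _ vx ux) gv.
  by have := gm _ _ vx ux; rewrite vu ih // gv wltxx.
have ff u : wlt u x -> f u = f' u.
  move=> ux; apply: contrapT => nff.
  have [|w [wx wff] wmin] := @wo_min a (fun u => wlt u x /\ f u <> f' u).
    by exists u.
  have ih v : wlt v w -> f v = f' v.
    move=> vw; apply: contrapT => nfv; move: (vw); rewrite /wlt wmin //.
    by split=> //; exact: wlt_trans wx.
  have ih' v : wlt v w -> f' v = f v by move/ih.
  have [?|//|?] := wlt_total (f w) (f' w).
    by apply: (key y y' f f' w).
  by apply: (key y' y f' f w).
have segE : seg y = seg y'.
  rewrite -fs -fs'; rewrite eqEsubset; split=> _ [u ux <-]; exists u => //.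
    by rewrite ff.
  by rewrite ff.
have [yy'|//|yy'] := wlt_total y y'.
  by have : seg y' y by []; rewrite -segE /seg /= wltxx.
by have : seg y y' by []; rewrite segE /seg /= wltxx.
Qed.

Lemma seg_isom_wlt (a b : Ord) (x x' : a) (y y' : b) f f' :
  seg_isom x y f -> seg_isom x' y' f' -> wlt x x' -> wlt y y'.
Proof.
move=> e e' xx'; rewrite (seg_isom_uniq e (seg_isom_sub e' xx')).
by have [_ fs'] := e'; have : (f' @` seg x') (f' x); [exists x|rewrite fs'].
Qed.

Lemma seg_isom_wle (a b : Ord) (x x' : a) (y y' : b) f f' :
  seg_isom x y f -> seg_isom x' y' f' -> wle x x' = wle y y'.
Proof.
move=> e e'; have [xx'|xx'|xx'] := wlt_total x x'.
- by rewrite (wltW xx') (wltW (seg_isom_wlt e e' xx')).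
- by subst x'; rewrite (seg_isom_uniq e e') !wle_refl.
- by rewrite (negbTE xx') (negbTE (seg_isom_wlt e' e xx')).
Qed.

Lemma olt_total a b : [\/ olt a b, oiso a b | olt b a].
Proof.
pose R (x : a) (y : b) := exists f, seg_isom x y f.
have Rlow x y y' : R x y -> wlt y' y -> exists x', R x' y'.
  move=> [f e] yy'; have : (f @` seg x) y' by have [_ ->] := e.
  by move=> [u ux <-]; exists u, f; exact: seg_isom_sub e ux.
have Rlowl x x' y : R x y -> wlt x' x -> exists y', R x' y'.
  by move=> [f e] xx'; exists (f x'), f; exact: seg_isom_sub e xx'.
have [Da|/existsNP nDa] := pselect (forall x, exists y, R x y).
  have [h hR] := choice Da.
  have hm : {mono h : x y / wle x y}.
    by move=> x y; have [f e] := hR x; have [g e'] := hR y; rewrite (seg_isom_wle e e').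
  have [Rb|/existsNP nRb] := pselect (forall y, exists x, R x y).
    constructor 2; apply: (oisoI hm) => y; have [x [f e]] := Rb y.
    by exists x; have [g e'] := hR x; exact: seg_isom_uniq e' e.
  constructor 1; have [y ny ymin] := wo_min nRb; exists y.
  have hP x : h x \in seg y.
    rewrite inE /seg /= /wlt; apply/negP => yh.
    have [yE|yh'] := pselect (y = h x); first by apply: ny; exists x; rewrite yE.
    by apply: ny; apply: Rlow (hR x) _; apply/negP => hy; apply: yh'; exact: wle_anti.
  apply: (@oisoI _ (otp (seg y)) (fun x => in_otp (hP x))) => [x x'|[w wy]].
    by rewrite /= -hm.
  have [[x [f e]]|nw] := pselect (exists x, R x w).
    exists x; apply: (@otp_inj b (seg y)) => /=.
    by have [g e'] := hR x; exact: seg_isom_uniq e' e.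
  by move: (set_mem wy); rewrite /seg /= /wlt ymin.
have [x nx xmin] := wo_min nDa.
have sx u : wlt u x -> exists y, R u y.
  by move=> ux; apply: contrapT => nu; move: ux; rewrite /wlt xmin.
have xs u y : R u y -> wlt u x.
  move=> Ruy; apply/negP => xu; apply: nx.
  have [->|nxu] := pselect (x = u); first by exists y.
  by apply: Rlowl Ruy _; apply/negP => ux; apply: nxu; exact: wle_anti.
have [h hR] : {h : otp (seg x) -> b & forall u : seg x, R (val u) (h u)}.
  apply: (@choice (otp (seg x)) b (fun u y => R (val (u : seg x)) y)) => u.
  by apply: sx; exact: set_mem (valP (u : seg x)).
have hm : {mono h : u v / wle u v}.
  by move=> u v; have [f e] := hR u; have [g e'] := hR v; rewrite /= (seg_isom_wle e e').
have hs u y : R u y -> exists v, h v = y.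
  move=> Ruy; have ux : u \in seg x by apply: mem_set; exact: xs Ruy.
  exists (in_otp ux); have [f e] := hR (in_otp ux).
  by have [g e'] := Ruy; exact: seg_isom_uniq e e'.
have [Rb|/existsNP nRb] := pselect (forall y, exists x, R x y).
  constructor 3; exists x; apply: oiso_sym.
  by apply: (oisoI hm) => y; have [u /hs] := Rb y.
exfalso; have [y ny ymin] := wo_min nRb.
have ys u v : R u v -> wlt v y.
  move=> Ruv; apply/negP => yv; apply: ny.
  have [->|nyv] := pselect (y = v); first by exists u.
  by apply: Rlow Ruv _; apply/negP => vy; apply: nyv; exact: wle_anti.
have sy v : wlt v y -> exists u, R u v.
  by move=> vy; apply: contrapT => nv; move: vy; rewrite /wlt ymin.
pose f (u : a) : b := if pselect (exists v, R u v) is left e then projT1 (cid e) else y.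
have fR u : wlt u x -> R u (f u).
  move=> ux; rewrite /f; case: pselect => [e|]; last by move/(_ (sx _ ux)).
  by case: cid.
apply: nx; exists y, f; split=> [u v /fR[g e] /fR[g' e']|].
  by rewrite /wlt (seg_isom_wle e' e).
rewrite eqEsubset; split=> [_ [u ux <-]|v vy]; first exact: ys (fR _ ux).
have [u Ruv] := sy _ vy; exists u; first exact: xs Ruv.
by have [g e] := fR _ (xs _ _ Ruv); have [g' e'] := Ruv; exact: seg_isom_uniq e e'.
Qed.

Lemma olt_seg (a b : Ord) (x : b) : olt a (otp (seg x)) -> exists2 y, wlt y x & oiso a (otp (seg y)).
Proof.
move=> [[z zx] az]; exists z; first exact: set_mem zx.
apply: oiso_trans az _.
have P (u : seg (in_otp zx)) : val (val u : seg x) \in seg z.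
  by rewrite inE; have := set_mem (valP u).
pose f (u : otp (seg (in_otp zx))) : otp (seg z) := in_otp (P u).
apply: (@oisoI _ _ f) => // -[w wz].
have wx : w \in seg x.
  by rewrite inE; apply: wlt_trans (set_mem wz) _; exact: set_mem zx.
have wx' : (in_otp wx) \in seg (in_otp zx).
  by rewrite inE; exact: set_mem wz.
by exists (in_otp wx'); exact: otp_inj.
Qed.

Lemma olt_oiso b a c : olt a b -> oiso b c -> olt a c.
Proof.
move=> [x ax] [f [g fg gf] fm]; exists (f x); apply: oiso_trans ax _.
have P (u : seg x) : f (val u) \in seg (f x).
  by rewrite inE /seg /= /wlt fm; exact: set_mem (valP u).
pose h (u : otp (seg x)) : otp (seg (f x)) := in_otp (P u).
apply: (@oisoI _ _ h).
  by move=> u v; rewrite /= fm.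
move=> [w wx]; have gx : g w \in seg x.
  by rewrite inE /seg /= /wlt -fm gf; exact: set_mem wx.
by exists (in_otp gx); apply: otp_inj; rewrite /= gf.
Qed.

Lemma olt_irr a : ~ olt a a.
Proof.
move=> [x [f _ fm]]; pose h (u : a) : a := val (f u : seg x).
have hm : {mono h : u v / wle u v} by exact: fm.
have [|y hy ymin] := @wo_min a (fun y => wlt (h y) y).
  by exists x; exact: set_mem (valP (f x : seg x)).
by move: (hy); rewrite /wlt ymin // /wlt hm.
Qed.

Lemma olt_ole_false a b : olt a b -> ~ ole b a.
Proof.
move=> ab [ba|ba]; last exact: olt_irr (olt_oiso ab ba).
have [x ax] := ab; have [y yx by_] := olt_seg (olt_oiso ba ax).
by apply: (@olt_irr b); exists y.
Qed.

Theorem least_exists (P : Ord -> Prop) :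
  (exists a, P a) -> exists a, P a /\ forall b, P b -> ole a b.
Proof.
move=> [a Pa]; pose S (x : a) := exists2 d, P d & oiso d (otp (seg x)).
have [[x Sx]|nS] := pselect (exists x, S x); last first.
  exists a; split=> // b Pb; have [|?|[x bx]] := olt_total a b; [by left|by right|].
  by case: nS; exists x, b.
have [x0 [d Pd dx] xmin] := wo_min (ex_intro S x Sx).
exists d; split=> // b Pb; have [|?|bd] := olt_total d b; [by left|by right|].
have [y yx biso] := olt_seg (olt_oiso bd dx).
by move: yx; rewrite /wlt xmin //; exists b.
Qed.

Definition oleast (P : Ord -> Prop) (exP : exists a, P a) : Ord :=
  projT1 (cid (least_exists exP)).

Lemma oleastP (P : Ord -> Prop) (exP : exists a, P a) :
  P (oleast exP) /\ forall b, P b -> ole (oleast exP) b.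
Proof. exact: projT2 (cid (least_exists exP)). Qed.

(* Initial ordinals, finite ones included. *)
Definition is_cardinal (a : Ord) : Prop :=
  forall g, olt g a -> [set: g] #!= [set: a].

Lemma inj_setT_card_le (T U : Type) (f : T -> U) :
  injective f -> [set: T] #<= [set: U].
Proof.
move=> fi; suff: $|{injfun [set: T] >-> [set: U]}| by move=> [g]; exact: inj_card_le g.
by apply/injfunPex; exists f => // x y _ _; exact: fi.
Qed.

Lemma card_le_setT_inj (T U : Type) :
  [set: T] #<= [set: U] -> exists f : T -> U, injective f.
Proof.
move=> /card_leP[g]; exists (fun x => val (g (exist _ x (mem_set I)))).
by move=> x y /val_inj /(@inj _ _ _ g)-/(_ (mem_set I) (mem_set I))[].
Qed.

Lemma oiso_card_le a b : oiso a b -> [set: a] #<= [set: b].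
Proof. by case=> f fb _; apply: inj_setT_card_le (bij_inj fb). Qed.

Lemma olt_card_le a b : olt a b -> [set: a] #<= [set: b].
Proof.
move=> [x /oiso_card_le ax]; apply: card_le_trans ax _.
by apply: (@inj_setT_card_le _ _ (fun u : otp (seg x) => val (u : seg x))); exact: val_inj.
Qed.

Definition card_lt (T U : Type) (A : set T) (B : set U) : bool :=
  (A #<= B) && (A #!= B).

Lemma succ_card_exists (l : Ord) : exists a, is_cardinal a /\ olt l a.
Proof.
pose T := (l -> Prop) : Type.
have [R Rwo] := well_ordering_principle {eclassic T}.
have nT : ~ ([set: MkOrd Rwo] #<= [set: l]).
  move=> /card_le_setT_inj[f fi].
  pose d x := exists2 B : T, f B = x & ~ B x.
  have nd : ~ d (f d) by move=> [B /fi BE]; rewrite BE => nd; apply: (nd); exists d.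
  by apply: (nd); exists d.
have [a [na amin]] := least_exists (ex_intro (fun c : Ord => ~ ([set: c] #<= [set: l])) _ nT).
exists a; split=> [g ga|].
  apply/negP; rewrite card_eq_le => /andP[_ ag].
  have [gl|ngl] := pselect ([set: g] #<= [set: l]); first exact: na (card_le_trans ag gl).
  exact: olt_ole_false ga (amin _ ngl).
by have [/olt_card_le|/oiso_card_le|] := olt_total a l.
Qed.

Definition succ_card (l : Ord) : Ord := oleast (succ_card_exists l).

(* As sets of ordinals, the supremum of A is the union of A. *)
Definition osup (a : Ord) (A : set a) : set a := \bigcup_(x in A) seg x.

Definition cofinal (a : Ord) (A : set a) : Prop :=
  forall x, exists2 y, A y & wle x y.

Lemma cf_exists (a : Ord) : exists d, exists2 A : set a, cofinal A & oiso (otp A) d.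
Proof.
exists (otp [set: a]), setT; last exact: oiso_refl.
by move=> x; exists x => //; exact: wle_refl.
Qed.

Definition cf (a : Ord) : Ord := oleast (cf_exists a).

Definition club (a : Ord) (d C : set a) : Prop :=
  [/\ C `<=` d, osup C = d
    & forall x, d x -> seg x !=set0 -> osup (C `&` seg x) = seg x -> C x].

Definition stationary (a : Ord) (d A : set a) : Prop :=
  forall C, club d C -> A `&` C !=set0.

(* A two-element subset of a, listed in increasing order; hi is its maximum. *)
Record pair2 (a : Ord) := Pair2 { lo : a; hi : a; lo_hi : wlt lo hi }.

Definition pairs (a : Ord) (A : set a) : set (pair2 a) :=
  [set p | A (lo p) /\ A (hi p)].

Definition normal_coloring (k l : Ord) (f : pair2 k -> l) : Prop :=
  forall p q, f p = f q -> hi p = hi q.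

Definition rainbow (k l : Ord) (f : pair2 k -> l) (A : set k) : Prop :=
  set_inj (pairs A) f.

(* t_{eta, beta} for p = {eta, beta} *)
Definition tset (k l : Ord) (f : pair2 k -> l) (p : pair2 k) : set k :=
  [set lo q | q in [set q | hi q = hi p /\ f q = f p]].

Definition type_bounded (alpha k : Ord) (f : pair2 k -> k) : Prop :=
  exists2 g, olt g alpha & forall p, ole (otp (tset f p)) g.

(* k --> (m)^2_{l, <r} *)
Definition arrow (k m l r : Ord) : Prop :=
  forall f : pair2 k -> l,
  exists2 A : set k, oiso (otp A) m & card_lt (f @` pairs A) [set: r].

(* k --> (m-st)^2_{l, <r} *)
Definition arrow_st (k m l r : Ord) : Prop :=
  forall f : pair2 k -> l,
  exists A : set k, [/\ oiso (otp A) m, stationary (osup A) A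
                      & card_lt (f @` pairs A) [set: r]].

(* k -->poly (t)^2_{<alpha-t-bdd} *)
Definition poly (k t alpha : Ord) : Prop :=
  forall f : pair2 k -> k, normal_coloring f -> type_bounded alpha f ->
  exists2 A : set k, oiso (otp A) t & rainbow f A.

(* k -->poly (m-st)^2_{<alpha-t-bdd} *)
Definition poly_st (k m alpha : Ord) : Prop :=
  forall f : pair2 k -> k, normal_coloring f -> type_bounded alpha f ->
  exists A : set k, [/\ oiso (otp A) m, stationary (osup A) A & rainbow f A].

(* k -->poly (par(<cf k))^2_{<alpha-t-bdd} *)
Definition poly_par (k alpha : Ord) : Prop :=
  forall f : pair2 k -> k, normal_coloring f -> type_bounded alpha f ->
  exists2 g : Ord, olt g (cf k)
    & exists h : k -> g, forall i : g, rainbow f (h @^-1` [set i]).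

(* Main.v *)
From mathcomp Require Import all_boot.
From mathcomp Require Import boolp classical_sets functions cardinality wochoice.
Require Import Defs.

(** The first half is a thinning argument.  Given a normal [f] with classes of
    type at most [g], with [g] below the successor of [lambda], color a pair by the
    position of its lower point inside its class: since [g] has size at most
    [lambda], this is a coloring with [lambda] colors, to which the hypothesis on
    [kappa] applies.  On the resulting set [A] of type [mu] fewer than [rho]
    positions occur, and each class within [A] embeds, through the positions, in
    the order type of the set of these positions, which is an ordinal below [rho]
    ([thin_bounded]).  Transported to [mu] and recolored ([poly_recolor]), [f] on
    [A] satisfies the hypothesis on [mu], and rainbow sets are carried back.

    For the second half, thin in the same way and call a subset of [mu] positive
    when its image is stationary in the supremum of [A].  As the cofinality of
    [mu] is uncountable, fewer than [cf mu] nonpositive sets never cover a positive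
    one ([stationary_fiber], via [club_bigcap]); so some rainbow piece [D] of the
    given partition is positive.  If [D] has size [mu], it is the required set.
    This always happens for regular [mu], but when [mu] is singular all positive
    pieces may be too small.  Then [D] is combined with a piece of size [mu]
    ([positive_rainbow]).  Conflicts involving two points of the large piece are
    removed by a free set theorem in the style of Hajnal ([free_set]), and
    conflicts of two points of [D] below a point of the large piece by a second
    use of the partition hypothesis, for an auxiliary coloring of [mu] many stacked
    copies of [D] ([positive_many_injective]).  The order type of that stack is
    [mu] and colors can be renamed by elements of [mu] because infinite cardinals
    equal their squares ([square_infinite]). *)

Set Implicit Arguments.
Unset Strict Implicit.
Unset Printing Implicit Defensive.

Local Open Scope classical_set_scope.
Local Open Scope card_scope.

(** * Order types and increasing maps *)

Lemma wle_wlt_trans (a : Ord) (y x z : a) : wle x y -> wlt y z -> wlt x z.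
Proof. by move=> xy; apply: contra => zx; apply: wle_trans xy. Qed.

Lemma wlt_wle_trans (a : Ord) (y x z : a) : wlt x y -> wle y z -> wlt x z.
Proof. by move=> xy yz; apply: contra xy; apply: wle_trans. Qed.

Lemma wlt_wo_min (a : Ord) (P : a -> Prop) :
  (exists x, P x) -> exists2 x, P x & forall y, wlt y x -> ~ P y.
Proof.
move=> /wo_min[x Px xmin]; exists x => // y yx Py.
by move: yx; rewrite /wlt xmin.
Qed.

Definition increasing (a b : Ord) (e : a -> b) : Prop :=
  forall x y, wlt x y -> wlt (e x) (e y).

Lemma increasing_mono (a b : Ord) (e : a -> b) :
  increasing e -> {mono e : x y / wle x y}.
Proof.
move=> ei x y; have [xy|->|yx] := wlt_total x y.
- by rewrite (wltW xy) (wltW (ei _ _ xy)).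
- by rewrite !wle_refl.
- by rewrite (negbTE yx) (negbTE (ei _ _ yx)).
Qed.

Lemma increasing_inj (a b : Ord) (e : a -> b) : increasing e -> injective e.
Proof.
by move=> ei x y exy; apply: wle_anti; rewrite -(increasing_mono ei) exy wle_refl.
Qed.

Lemma increasing_comp (a b c : Ord) (e : a -> b) (d : b -> c) :
  increasing e -> increasing d -> increasing (d \o e).
Proof. by move=> ei di x y /ei /di. Qed.

Lemma otp_val_increasing (a : Ord) (A : set a) :
  increasing (fun x : otp A => val (x : A)).
Proof. by []. Qed.

Lemma increasing_oiso (a b : Ord) (e : a -> b) :
  increasing e -> (forall y, exists x, e x = y) -> oiso a b.
Proof. by move=> /increasing_mono em es; apply: (oisoI em). Qed.

Lemma oiso_increasing (a b : Ord) : oiso a b ->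
  exists2 e : a -> b, increasing e & forall y, exists x, e x = y.
Proof.
case=> e [d ed de] em; exists e; first by move=> x y; rewrite /wlt em.
by move=> y; exists (d y).
Qed.

(** An increasing self-map never moves a point down, so [a] has no increasing
    map into one of its proper initial segments. *)
Lemma increasing_ole (a b : Ord) (e : a -> b) : increasing e -> ole a b.
Proof.
move=> ei; have [|?|[x /oiso_increasing[d di _]]] := olt_total a b; [by left|by right|].
have [|y ey ymin] := @wlt_wo_min a (fun y => wlt (val (d (e y) : seg x)) y).
  exists x; exact: set_mem (valP (d (e x) : seg x)).
by case: (ymin _ ey); apply/di/ei.
Qed.

Lemma olt_increasing (a b : Ord) : olt a b -> exists e : a -> b, increasing e.
Proof.
move=> [x /oiso_increasing[e ei _]]; exists (fun y => val (e y : seg x)).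
exact: ei.
Qed.

Lemma ole_increasing (a b : Ord) : ole a b -> exists e : a -> b, increasing e.
Proof. by move=> [/olt_increasing //|/oiso_increasing[e ei _]]; exists e. Qed.

Lemma ole_trans (b a c : Ord) : ole a b -> ole b c -> ole a c.
Proof.
move=> /ole_increasing[e ei] /ole_increasing[d di].
exact: increasing_ole (increasing_comp ei di).
Qed.

Lemma ole_total (a b : Ord) : ole a b \/ olt b a.
Proof. by have [?|?|?] := olt_total a b; [left; left|left; right|right]. Qed.

Lemma ole_olt_trans (b a c : Ord) : ole a b -> olt b c -> olt a c.
Proof.
move=> ab bc; have [ca|//] := ole_total c a.
by case: (olt_ole_false bc); apply: ole_trans ab.
Qed.

Lemma olt_segT (a : Ord) (x : a) : olt (otp (seg x)) a.
Proof. by exists x; exact: oiso_refl. Qed.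

Lemma otp_range (a b : Ord) (e : b -> a) :
  increasing e -> oiso (otp (range e)) b.
Proof.
move=> ei; apply: oiso_sym.
have eP x : e x \in range e by rewrite inE; exists x.
apply: (@increasing_oiso _ (otp (range e)) (fun x => in_otp (eP x))) => [x y /ei //|].
move=> [y yP]; have [x _ xy] := set_mem yP; exists x; exact: otp_inj.
Qed.

Lemma otp_image (a b : Ord) (e : b -> a) (R : set b) :
  increasing e -> oiso (otp (e @` R)) (otp R).
Proof.
move=> ei; have -> : e @` R = range (fun x : otp R => e (val (x : R))).
  rewrite eqEsubset; split=> [_ [x Rx <-]|_ [x _ <-]].
    by exists (in_otp (mem_set Rx)).
  by exists (val (x : R)) => //; exact: set_mem (valP (x : R)).
by apply: otp_range => x y /ei.
Qed.

Lemma otp_enum (a b : Ord) (A : set a) : oiso (otp A) b ->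
  exists2 e : b -> a, increasing e & range e = A.
Proof.
move=> /oiso_sym/oiso_increasing[e ei es]; exists (fun x => val (e x : A)); first exact: ei.
rewrite eqEsubset; split=> [_ [x _ <-]|x Ax]; first exact: set_mem (valP (e x : A)).
by have [y ey] := es (in_otp (mem_set Ax)); exists y; rewrite ?ey.
Qed.

(** * Cardinal comparison *)

Lemma card_leI T U (A : set T) (B : set U) (f : T -> U) :
  (forall x, A x -> B (f x)) ->
  (forall x y, A x -> A y -> f x = f y -> x = y) -> A #<= B.
Proof.
move=> fAB fi.
suff: $|{injfun A >-> B}| by move=> [g]; exact: inj_card_le g.
by apply/injfunPex; exists f => // x y /set_mem Ax /set_mem Ay; exact: fi.
Qed.

Lemma card_leE T U (A : set T) (B : set U) (u0 : U) : A #<= B ->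
  exists2 f : T -> U, (forall x, A x -> B (f x)) &
    forall x y, A x -> A y -> f x = f y -> x = y.
Proof.
move=> /card_leP[g].
pose f x := if pselect (A x) is left Ax then val (g (exist _ x (mem_set Ax))) else u0.
have fE x (Ax : A x) : f x = val (g (exist _ x (mem_set Ax))).
  by rewrite /f; case: pselect => // Ax'; rewrite (Prop_irrelevance Ax' Ax).
exists f => [x Ax|x y Ax Ay]; first by rewrite fE; exact: set_mem (valP _).
rewrite !fE => /val_inj /(@inj _ _ _ g)-/(_ (mem_set I) (mem_set I)) xy.
exact: (congr1 val xy).
Qed.

Lemma card_le_nonempty T U (A : set T) (B : set U) : A #<= B ->
  A !=set0 -> B !=set0.
Proof.
move=> AB [x Ax]; apply/set0P/negP => /eqP B0; move: AB; rewrite B0 => /card_le0P A0.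
by rewrite A0 in Ax.
Qed.

Lemma card_setX_le T U T' U' (A : set T) (B : set U) (A' : set T') (B' : set U') :
  A #<= A' -> B #<= B' -> A `*` B #<= A' `*` B'.
Proof.
move=> AA' BB'; have [->|/set0P[[x y] [/= Ax By]]] := eqVneq (A `*` B) set0.
  exact: card_ge0.
have [x' _] := card_le_nonempty AA' (ex_intro _ x Ax).
have [y' _] := card_le_nonempty BB' (ex_intro _ y By).
have [f fA fi] := card_leE x' AA'; have [g gB gi] := card_leE y' BB'.
apply: (@card_leI _ _ _ _ (fun p => (f p.1, g p.2))) => [p [/fA ? /gB ?] //|].
by move=> [u v] [s t] [/= Au Bv] [/= As Bt] [/(fi _ _ Au As)-> /(gi _ _ Bv Bt)->].
Qed.

Lemma card_bigcup_le T I U (D : set I) (A : I -> set T) (B : set U) :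
  (forall i, D i -> A i #<= B) -> \bigcup_(i in D) A i #<= D `*` B.
Proof.
move=> AB; have [->|/set0P[x0 [i0 Di0 Ax0]]] := eqVneq (\bigcup_(i in D) A i) set0.
  exact: card_ge0.
have [u0 _] := card_le_nonempty (AB _ Di0) (ex_intro _ x0 Ax0).
have fex i : exists f : T -> U, D i -> (forall x, A i x -> B (f x)) /\
    forall x y, A i x -> A i y -> f x = f y -> x = y.
  have [Di|nDi] := pselect (D i); last by exists (fun=> u0).
  by have [g ? ?] := card_leE u0 (AB _ Di); exists g.
have [f fP] := choice fex.
have kex x : exists i, (\bigcup_(i in D) A i) x -> D i /\ A i x.
  have [[i Di Aix]|nx] := pselect ((\bigcup_(i in D) A i) x); first by exists i.
  by exists i0.
have [k kP] := choice kex.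
apply: (@card_leI _ _ _ _ (fun x => (k x, f (k x) x))) => [x /kP[Dk Ak]|x y].
  by split=> //=; exact: (fP _ Dk).1.
move=> /kP[Dk Ak] /kP[_ Aky] [kxy]; rewrite -kxy in Aky *.
exact: (fP _ Dk).2.
Qed.

Lemma card_le_set_type T (A : set T) : [set: A] #<= A.
Proof. by have := card_setT A; rewrite card_eq_le => /andP[]. Qed.

Lemma card_ge_set_type T (A : set T) : A #<= [set: A].
Proof. by have := card_setT A; rewrite card_eq_le => /andP[]. Qed.

Lemma otp_card_le (a : Ord) (A : set a) : [set: otp A] #<= A.
Proof. exact: card_le_set_type. Qed.

Lemma card_le_otp (a : Ord) (A : set a) : A #<= [set: otp A].
Proof. exact: card_ge_set_type. Qed.

Lemma ole_card_le (a b : Ord) : ole a b -> [set: a] #<= [set: b].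
Proof. by move=> [/olt_card_le|/oiso_card_le]. Qed.

Lemma type_wo (T : Type) : exists a : Ord, [set: T] #= [set: a].
Proof.
have [R Rwo] := well_ordering_principle {classic T}.
by exists (MkOrd Rwo); exact: card_eqxx.
Qed.

(** For an initial ordinal [m], these are the sets of size less than [m]. *)
Definition small (m : Ord) T (A : set T) : bool := ~~ ([set: m] #<= A).

Lemma small_le (m : Ord) T U (A : set T) (B : set U) :
  small m B -> A #<= B -> small m A.
Proof. by move=> sB AB; apply: contra sB => mA; apply: card_le_trans AB. Qed.

Lemma small_le_seg (m : Ord) T (A : set T) : small m A -> exists x : m, A #<= seg x.
Proof.
have [a] := type_wo A; rewrite card_eq_le => /andP[Aa aA] sA.
have [/ole_card_le ma|[x ax]] := ole_total m a.
  case/negP: sA; apply: card_le_trans ma _.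
  by apply: card_le_trans aA _; exact: card_le_set_type.
exists x; apply: card_le_trans (card_ge_set_type _) _.
by apply: card_le_trans Aa _; exact: card_le_trans (oiso_card_le ax) (otp_card_le _).
Qed.

(** * Lexicographic products and the square of an infinite cardinal *)

Definition lex_le (a b : Ord) : rel (a * b) :=
  fun p q => wlt p.1 q.1 || (wle p.1 q.1 && wle p.2 q.2).

Lemma lex_wo (a b : Ord) : well_order (@lex_le a b).
Proof.
apply: antisymmetric_well_order => [[x u] [y v]|A [p Ap]].
  rewrite /lex_le /=; have [xy|<-|yx] := wlt_total x y.
  - by rewrite xy (negbTE xy) /= /wlt (wltW xy).
  - by rewrite wltxx wle_refl /= => /andP[uv vu]; rewrite (wle_anti uv vu).
  - by rewrite yx (negbTE yx) /= /wlt (wltW yx).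
have [|x [u Axu] xmin] := @wo_min a (fun x => exists u, (x, u) \in A).
  by exists p.1, p.2; rewrite -surjective_pairing.
have [|v Axv vmin] := @wo_min b (fun u => (x, u) \in A); first by exists u.
exists (x, v); split=> // -[y w] Ayw; rewrite /lex_le /=.
have xy : wle x y by apply: xmin; exists w.
have [|xy'|yx] := wlt_total x y; [by move=> ->|subst y|by move: yx; rewrite /wlt xy].
by rewrite wle_refl vmin ?orbT.
Qed.

Definition lexO (a b : Ord) : Ord := MkOrd (@lex_wo a b).

Lemma lex_wlt (a b : Ord) (p q : lexO a b) :
  wlt p q <-> wlt p.1 q.1 \/ p.1 = q.1 /\ wlt p.2 q.2.
Proof.
case: p q => [x u] [y v]; rewrite {1}/wlt /= /lex_le /=.
have [xy|<-|yx] := wlt_total x y.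
- by rewrite xy (negbTE xy) /= {1}/wlt (wltW xy); split=> // _; left.
- by rewrite wltxx wle_refl /=; split=> [|[//|[]]]; [right|].
- rewrite {1}yx /= {1}/wlt (wltW yx); split=> // -[//|[xy _]].
  by move: yx; rewrite xy wltxx.
Qed.

Definition upto (a : Ord) (x : a) : set a := [set y | wle y x].

(** Two points below [x] already let [seg x] squared absorb the extra point. *)
Lemma upto_card_le (a : Ord) (x : a) : infinite_set (seg x) ->
  upto x #<= seg x `*` seg x.
Proof.
move=> /infiniteP /(card_leE x)[i ix ii].
have i01 : i 0 <> i 1 by move=> e; have := ii 0 1 I I e.
pose f y := if pselect (y = x) then (i 1, i 0) else (i 0, y).
apply: (@card_leI _ _ _ _ f) => [y yx|y z _ _]; rewrite /f.
  case: (pselect (y = x)) => [?|nyx] /=; split; try exact: ix.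
  by rewrite /seg /= /wlt; apply/negP => /(wle_anti yx).
case: (pselect (y = x)) => [yx|?]; case: (pselect (z = x)) => [zx|?] //=.
- by move=> _; rewrite yx zx.
- by case=> /esym.
- by case=> /i01.
- by case.
Qed.

(** Goedel's ordering of pairs by their maximum, then lexicographically: its
    segments below a pair with maximum [m] are contained in [upto m] squared. *)
Lemma square_infinite (a : Ord) : infinite_set [set: a] ->
  [set: a] `*` [set: a] #<= [set: a].
Proof.
pose P (b : Ord) := infinite_set [set: b] /\ ~ ([set: b] `*` [set: b] #<= [set: b]).
move=> ainf; apply: contrapT => na.
have [b [[binf nb] bmin]] := least_exists (ex_intro P a (conj ainf na)).
have IH (x : b) : infinite_set (seg x) -> seg x `*` seg x #<= seg x.
  move=> xinf; apply: contrapT => nx; apply: (olt_ole_false (olt_segT x)).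
  apply: bmin; split.
    by move=> /finite_set_leP[n xn]; apply: xinf; apply/finite_set_leP; exists n;
      exact: card_le_trans (card_le_otp _) xn.
  move=> sq; apply: nx; apply: card_le_trans (otp_card_le (seg x)).
  apply: card_le_trans sq; apply: card_setX_le; exact: card_le_otp.
pose mx (p : b * b) := if wle p.1 p.2 then p.2 else p.1.
have mx1 p : wle p.1 (mx p) by rewrite /mx; case: ifP => // _; exact: wle_refl.
have mx2 p : wle p.2 (mx p).
  rewrite /mx; case: ifP => [_|/negbT]; first exact: wle_refl.
  exact: wltW.
pose S : set (lexO b (lexO b b)) := [set t | t.1 = mx t.2].
have bS : [set: b] `*` [set: b] #<= [set: otp S].
  apply: card_le_trans (card_le_otp S).
  apply: (@card_leI _ _ _ _ (fun p => (mx p, p) : lexO b (lexO b b))) => //.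
  by move=> p q _ _ [].
have [/ole_card_le Sb|[[t tS] bt]] := ole_total (otp S) b.
  by apply: nb; apply: card_le_trans Sb.
have bm : [set: b] #<= upto t.1 `*` upto t.1.
  apply: card_le_trans (oiso_card_le bt) _; apply: card_le_trans (otp_card_le _) _.
  apply: (@card_leI _ _ _ _ (fun s : otp S => (val (s : S)).2)).
    move=> [s sS] /= st; have sm : wle s.1 t.1.
      have : wlt s t by exact: st.
      by move=> /lex_wlt[/wltW //|[-> _]]; exact: wle_refl.
    have /= sE := set_mem sS; split=> /=; rewrite /upto /=;
      by apply: wle_trans sm; rewrite sE.
  move=> [s sS] [r rS] _ _ /= sr; apply: val_inj => /=.
  have /= sE := set_mem sS; have /= rE := set_mem rS.
  by rewrite (surjective_pairing s) (surjective_pairing r) sE rE sr.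
have tinf : infinite_set (seg t.1).
  move=> tfin; apply: binf; apply: card_le_finite bm _.
  have -> : upto t.1 = seg t.1 `|` [set t.1].
    rewrite eqEsubset; split=> [y yt|y [/wltW //|->]]; last exact: wle_refl.
    have [|->|ty] := wlt_total y t.1; [by left|by right|].
    by move: ty; rewrite /wlt yt.
  by apply: finite_setX; rewrite finite_setU; split=> //; exact: finite_set1.
have bs : [set: b] #<= seg t.1.
  apply: card_le_trans bm _; apply: card_le_trans (IH _ tinf).
  by apply: card_setX_le; apply: card_le_trans (upto_card_le tinf) (IH _ tinf).
apply: nb; apply: card_le_trans (card_setX_le bs bs) _.
by apply: card_le_trans (IH _ tinf) _; exact: subset_card_le.
Qed.

(** * Small sets *)

Lemma card_setU_le T U (A B : set T) (C : set U) :
  A #<= C -> B #<= C -> A `|` B #<= [set: bool] `*` C.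
Proof.
move=> AC BC; have -> : A `|` B = \bigcup_(i in [set: bool]) (if i then A else B).
  rewrite eqEsubset; split=> [x [Ax|Bx]|x [[] _ ?]]; [by exists true|by exists false|by left|by right].
by apply: card_bigcup_le => -[].
Qed.

(** The range of the family can have a larger order type than its index set, so
    the minimality of [cf m] is applied to the records of the family. *)
Lemma olt_cf_bounded (m g : Ord) (c : g -> m) : olt g (cf m) ->
  exists x, forall i, wlt (c i) x.
Proof.
move=> gcf; apply: contrapT => nb.
(* the records of [c] are cofinal as soon as the range of [c] is, and they are
   enumerated in increasing order *)
pose R := [set i | forall j, wlt j i -> wlt (c j) (c i)].
pose e (i : otp R) := c (val (i : R)).
have ei : increasing e.
  by move=> i j ij; apply: (set_mem (valP (j : R))); exact: ij.
have : ole (cf m) (otp (range e)).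
  apply: (oleastP (cf_exists m)).2; exists (range e); last exact: oiso_refl.
  move=> x; have [|i xi imin] := @wlt_wo_min g (fun i => wle x (c i)).
    apply: contrapT => nx; apply: nb; exists x => i; apply/negP => xi.
    by apply: nx; exists i.
  have iR : i \in R.
    rewrite inE => j /imin /negP nxj.
    by apply: wlt_wle_trans xi.
  by exists (c i) => //; exists (in_otp iR).
move=> cfR; apply: (olt_ole_false gcf); apply: ole_trans cfR _.
apply: ole_trans (or_intror (otp_range ei)) _.
exact: increasing_ole (@otp_val_increasing _ R).
Qed.

Lemma otp_setT (a : Ord) : oiso (otp [set: a]) a.
Proof.
apply: (@increasing_oiso _ _ (fun x : otp [set: a] => val (x : [set: a]))) => // y.
by exists (in_otp (mem_set (I : [set: a] y))).
Qed.

Lemma cf_ole (m : Ord) : ole (cf m) m.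
Proof.
apply: (oleastP (cf_exists m)).2; exists setT; last exact: otp_setT.
by move=> x; exists x => //; exact: wle_refl.
Qed.

Section SmallSets.
Variables (m : Ord).
Hypotheses (card_m : is_cardinal m) (m_inf : infinite_set [set: m]).

Lemma olt_small (g : Ord) : olt g m -> small m [set: g].
Proof.
move=> gm; apply/negP => mg; have /negP := card_m gm; apply.
by rewrite card_eq_le mg andbT; exact: olt_card_le.
Qed.

Lemma seg_small (x : m) : small m (seg x).
Proof. exact: small_le (olt_small (olt_segT x)) (card_le_otp _). Qed.

Lemma finite_small T (A : set T) : finite_set A -> small m A.
Proof. by move=> Afin; apply/negP => mA; apply: m_inf; exact: card_le_finite mA Afin. Qed.

(** Both factors embed in one segment; if that segment is infinite it absorbs
    its own square. *)
Lemma small_setX T U (A : set T) (B : set U) :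
  small m A -> small m B -> small m (A `*` B).
Proof.
move=> /small_le_seg[x Ax] /small_le_seg[y By].
have [z xz yz] : exists2 z : m, wle x z & wle y z.
  by case/orP: (wle_total x y) => xy; [exists y|exists x] => //; exact: wle_refl.
have Sz (w : m) : wle w z -> seg w `<=` seg z by move=> wz u /= /wlt_wle_trans; apply.
have ABz : A `*` B #<= seg z `*` seg z.
  apply: card_setX_le; first exact: card_le_trans Ax (subset_card_le (Sz _ xz)).
  exact: card_le_trans By (subset_card_le (Sz _ yz)).
have [zfin|zinf] := pselect (finite_set (seg z)).
  by apply: finite_small; apply: (card_le_finite ABz); exact: finite_setX.
apply: (small_le (seg_small z)); apply: card_le_trans ABz _.
have zinf' : infinite_set [set: otp (seg z)].
  by move=> fz; apply: zinf; exact: card_le_finite (card_le_otp _) fz.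
apply: card_le_trans (otp_card_le _); apply: card_le_trans (square_infinite zinf').
by apply: card_setX_le; exact: card_le_otp.
Qed.

Lemma small_setU T (A B : set T) : small m A -> small m B -> small m (A `|` B).
Proof.
move=> /small_le_seg[x Ax] /small_le_seg[y By].
have [z xz yz] : exists2 z : m, wle x z & wle y z.
  by case/orP: (wle_total x y) => xy; [exists y|exists x] => //; exact: wle_refl.
have Sz (w : m) : wle w z -> seg w `<=` seg z by move=> wz u /= /wlt_wle_trans; apply.
have sb : small m ([set: bool] `*` seg z).
  by apply: (small_setX _ (seg_small z)); apply: finite_small; exact: finite_finset.
apply: (small_le sb); apply: card_setU_le.
  exact: card_le_trans Ax (subset_card_le (Sz _ xz)).
exact: card_le_trans By (subset_card_le (Sz _ yz)).
Qed.

Lemma upto_small (x : m) : small m (upto x).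
Proof.
apply: (@small_le _ _ _ _ (seg x `|` [set x])); last first.
  apply: subset_card_le => y yx; have [|->|xy] := wlt_total y x; [by left|by right|].
  by move: xy; rewrite /wlt yx.
by apply: small_setU; [exact: seg_small|apply: finite_small; exact: finite_set1].
Qed.

Lemma not_smallT : ~~ small m [set: m].
Proof. by rewrite negbK; exact: card_lexx. Qed.

Lemma small_compl (A : set m) : small m A -> exists x, ~ A x.
Proof.
move=> sA; apply: contrapT => nA; have := not_smallT.
by have -> : [set: m] = A; [rewrite eqEsubset; split=> // x _; apply: contrapT => ?; apply: nA; exists x|rewrite sA].
Qed.

Lemma small_bigcup T I U (D : set I) (A : I -> set T) (B : set U) :
  small m D -> small m B -> (forall i, D i -> A i #<= B) ->
  small m (\bigcup_(i in D) A i).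
Proof. by move=> sD sB AB; exact: small_le (small_setX sD sB) (card_bigcup_le AB). Qed.

(** As there are fewer than [cf m] pieces, a single segment bounds all their
    sizes. *)
Lemma small_bigcup_cf T (g : Ord) (A : g -> set T) : olt g (cf m) ->
  (forall i, small m (A i)) -> small m (\bigcup_(i in [set: g]) A i).
Proof.
move=> gcf sA; have [c cP] := choice (fun i => small_le_seg (sA i)).
have [x cx] := olt_cf_bounded c gcf.
apply: (@small_bigcup _ _ _ _ _ (seg x)); last 1 first.
- move=> i _; apply: card_le_trans (cP i) _; apply: subset_card_le => y /= yc.
  exact: wlt_trans yc (cx i).
- apply: olt_small; case: (cf_ole m) => [cfm|cfm]; last exact: olt_oiso cfm.
  by apply: ole_olt_trans cfm; left.
- exact: seg_small.
Qed.

Lemma big_otp (A : set m) : ~~ small m A -> oiso (otp A) m.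
Proof.
rewrite negbK => mA.
have [Am|//] : ole (otp A) m by exact: increasing_ole (@otp_val_increasing _ A).
by case/negP: (olt_small Am); apply: card_le_trans mA (card_le_otp A).
Qed.

(** A well-order of size at least [m] all of whose proper segments are small
    has type [m]. *)
Lemma lex_oiso (d : Ord) : small m [set: d] -> [set: d] !=set0 ->
  oiso (lexO m d) m.
Proof.
move=> sd [d0 _]; have [/olt_small/negP[]|//|[p mp]] := olt_total (lexO m d) m.
  by apply: (@card_leI _ _ _ _ (fun x => (x, d0) : lexO m d)) => // x y _ _ [].
case/negP: (small_setX (upto_small p.1) sd).
apply: card_le_trans (oiso_card_le mp) _; apply: card_le_trans (otp_card_le _) _.
apply: subset_card_le => q /lex_wlt qp; split=> //=; rewrite /upto /=.
by case: qp => [/wltW //|[-> _]]; exact: wle_refl.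
Qed.

End SmallSets.

(** * Colorings of pairs up to renaming of colors *)

Lemma pair2_eq (a : Ord) (p q : pair2 a) : lo p = lo q -> hi p = hi q -> p = q.
Proof.
case: p q => [x y xy] [x' y' xy'] /= ? ?; subst.
by rewrite (bool_irrelevance xy xy').
Qed.

Definition map_pair (a b : Ord) (e : a -> b) (ei : increasing e) (p : pair2 a) : pair2 b :=
  Pair2 (ei _ _ (lo_hi p)).

Definition normal_on (k : Ord) (L : Type) (F : pair2 k -> L) : Prop :=
  forall p q, F p = F q -> hi p = hi q.

Definition twins (k : Ord) (L : Type) (F : pair2 k -> L) (p : pair2 k) : set k :=
  [set lo q | q in [set q | hi q = hi p /\ F q = F p]].

Definition classes_bounded (r k : Ord) (L : Type) (F : pair2 k -> L) : Prop :=
  exists2 g, olt g r & forall p, ole (otp (twins F p)) g.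

(** Normality, type boundedness and rainbow sets only see which pairs share a
    color, and there are only [m] many pairs; so colors may live in any type. *)
Lemma recode (m : Ord) (L : Type) (F : pair2 m -> L) : infinite_set [set: m] ->
  exists f : pair2 m -> m, forall p q, f p = f q <-> F p = F q.
Proof.
move=> m_inf; have [[p0]|np] := pselect (inhabited (pair2 m)); last first.
  have [|f _] := @choice (pair2 m) m (fun _ _ => True); last exists f.
    by move=> p; exists (lo p).
  by move=> p; case: np.
have : [set: pair2 m] #<= [set: m].
  apply: card_le_trans (square_infinite m_inf).
  apply: (@card_leI _ _ _ _ (fun p : pair2 m => (lo p, hi p))) => // p q _ _ [].
  exact: pair2_eq.
move=> /card_le_setT_inj[h hI].
have repex (c : L) : exists q, (exists p, F p = c) -> F q = c.
  by have [[p pc]|nc] := pselect (exists p, F p = c); [exists p|exists p0].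
have [rep repP] := choice repex; have repF p : F (rep (F p)) = F p by apply: repP; exists p.
exists (fun p => h (rep (F p))) => p q; split=> [/hI pq|->//].
by rewrite -(repF p) pq repF.
Qed.

Lemma recode_normal_bounded (m r : Ord) (L : Type) (F : pair2 m -> L) (f : pair2 m -> m) :
  (forall p q, f p = f q <-> F p = F q) -> normal_on F -> classes_bounded r F ->
  normal_coloring f /\ type_bounded r f.
Proof.
move=> fF Fn [g gr Fg]; split=> [p q /fF /Fn //|]; exists g => // p.
suff -> : tset f p = twins F p by [].
by rewrite eqEsubset; split=> _ [q [hq /fF fq] <-]; exists q.
Qed.

Lemma recode_rainbow (m : Ord) (L : Type) (F : pair2 m -> L) (f : pair2 m -> m) (A : set m) :
  (forall p q, f p = f q <-> F p = F q) -> rainbow f A -> set_inj (pairs A) F.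
Proof. by move=> fF fA p q pA qA /fF; exact: fA. Qed.

Lemma poly_recolor (m t r : Ord) (L : Type) (F : pair2 m -> L) :
  infinite_set [set: m] -> poly m t r -> normal_on F -> classes_bounded r F ->
  exists2 A : set m, oiso (otp A) t & set_inj (pairs A) F.
Proof.
move=> m_inf mtr Fn Fb; have [f fF] := recode F m_inf.
have [fn fb] := recode_normal_bounded fF Fn Fb.
by have [A At fA] := mtr _ fn fb; exists A => //; exact: recode_rainbow fF fA.
Qed.

(** A partition relation only depends on the order type of its domain. *)
Lemma poly_par_recolor (m v r : Ord) (L : Type) (F : pair2 v -> L) :
  infinite_set [set: m] -> poly_par m r -> oiso v m -> normal_on F -> classes_bounded r F ->
  exists2 g : Ord, olt g (cf m)
    & exists h : v -> g, forall i, set_inj (pairs (h @^-1` [set i])) F.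
Proof.
move=> m_inf mr vm Fn [b br Fb].
have /oiso_sym/oiso_increasing[d di ds] := vm.
have [e ed] := choice ds.
have ei : increasing e.
  by move=> x y xy; rewrite /wlt -(increasing_mono di) !ed.
have deK p : map_pair di (map_pair ei p) = p by apply: pair2_eq; exact: ed.
pose G (p : pair2 m) := F (map_pair di p).
have [f fG] := recode G m_inf.
have Gn : normal_on G by move=> p q /Fn /= /(increasing_inj di).
have Gb : classes_bounded r G.
  exists b => // p; apply: ole_trans (Fb (map_pair di p)).
  have dP (x : twins G p) : d (val x) \in twins F (map_pair di p).
    case: x => x /= /set_mem[q [hq Gq] <-]; rewrite inE.
    by exists (map_pair di q) => //=; rewrite hq.
  apply: (@increasing_ole _ _ (fun x : otp (twins G p) => in_otp (dP x))) => x y xy.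
  exact: (di _ _ xy).
have [fn fb] := recode_normal_bounded fG Gn Gb.
have [g gcf [h hP]] := mr f fn fb; exists g => //; exists (h \o e) => i p q.
move=> /set_mem[lp hp] /set_mem[lq hq] pq.
rewrite -(deK p) -(deK q); congr map_pair; apply: hP (i) _ _ _ _ _; rewrite ?inE //.
by apply/fG; rewrite /G !deK.
Qed.

(** * Thinning a coloring along a set with few positions *)

(** The position of [lo p] inside its own class, read in the bounding ordinal
    [g]; the class is only known to embed in [g], so an embedding is fixed for
    each set once and for all. *)
Lemma class_position (k g : Ord) (f : pair2 k -> k) :
  (forall p, ole (otp (tset f p)) g) ->
  exists pos : pair2 k -> g, forall p q, hi p = hi q -> f p = f q ->
    wlt (lo p) (lo q) -> wlt (pos p) (pos q).
Proof.
move=> fg; have [[i0]|ng] := pselect (inhabited g); last first.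
  have [|pos _] := @choice (pair2 k) g (fun _ _ => True); last exists pos.
    move=> p; have [e _] := ole_increasing (fg p).
    by case: ng; split; apply: (e (in_otp (mem_set _))); exists p.
  by move=> p; case: ng; split; exact: pos p.
have embex (S : set k) : exists e : k -> g, ole (otp S) g ->
    forall x y, S x -> S y -> wlt x y -> wlt (e x) (e y).
  have [/ole_increasing[e ei]|nS] := pselect (ole (otp S) g); last by exists (fun=> i0).
  exists (fun x => if pselect (S x) is left Sx then e (in_otp (mem_set Sx)) else i0).
  move=> _ x y Sx Sy xy; case: pselect => // Sx'; case: pselect => // Sy'.
  exact: ei.
have [emb embP] := choice embex.
exists (fun p => emb (tset f p) (lo p)) => p q pq fpq lpq.
have -> : tset f p = tset f q by rewrite /tset pq fpq.
by apply: embP => //; [exists p; rewrite /= ?pq ?fpq|exists q].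
Qed.

(** The least ordinal of the size of [g] is a cardinal below [succ_card l], so it
    cannot exceed [l]. *)
Lemma olt_succ_card (l g : Ord) : olt g (succ_card l) -> [set: g] #<= [set: l].
Proof.
move=> gl; apply: contrapT => ngl.
have [c [gc cmin]] := least_exists (ex_intro (fun c : Ord => [set: g] #<= [set: c]) g (card_lexx _)).
have lc : olt l c.
  have [cl|//] := ole_total c l.
  by case: ngl; apply: card_le_trans gc (ole_card_le cl).
have cc : is_cardinal c.
  move=> d dc; apply/negP; rewrite card_eq_le => /andP[_ cd].
  exact: (olt_ole_false dc (cmin _ (card_le_trans gc cd))).
apply: (olt_ole_false gl); apply: ole_trans (cmin _ (card_lexx _)).
exact: (oleastP (succ_card_exists l)).2.
Qed.

Lemma card_lt_olt (r : Ord) (g : Ord) (X : set g) : card_lt X [set: r] -> olt (otp X) r.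
Proof.
move=> /andP[Xr /negP nXr]; have [/ole_card_le rX|//] := ole_total r (otp X).
by case: nXr; rewrite card_eq_le Xr /=; exact: card_le_trans rX (otp_card_le _).
Qed.

(** If the positions take less than [r] values on a set, then on that set every
    class embeds, by its positions, in a fixed ordinal below [r]. *)
Lemma thin_bounded (k l r : Ord) (f : pair2 k -> k) :
  normal_coloring f -> type_bounded (succ_card l) f ->
  exists c : pair2 k -> l, forall (m : Ord) (e : m -> k) (ei : increasing e),
    card_lt (c @` pairs (range e)) [set: r] ->
    normal_on (f \o map_pair ei) /\ classes_bounded r (f \o map_pair ei).
Proof.
move=> fn [g gl fg]; have [pos posP] := class_position fg.
have [iota iotaI] := card_le_setT_inj (olt_succ_card gl).
exists (iota \o pos) => m e ei /andP[Xr Xr'].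
split=> [p q /fn /= /(increasing_inj ei) //|].
pose X := pos @` pairs (range e).
have XX : (iota \o pos) @` pairs (range e) #= X.
  by rewrite -image_comp; apply: inj_card_eq => x y _ _; exact: iotaI.
have Xlt : card_lt X [set: r] by rewrite /card_lt -(card_le_eql XX) -(card_eql XX) Xr Xr'.
exists (otp X); first exact: card_lt_olt.
move=> p; pose F := f \o map_pair ei.
have qex (x : m) : exists q, twins F p x -> [/\ hi q = hi p, F q = F p & lo q = x].
  by have [[q [? ?] ?]|nx] := pselect (twins F p x); [exists q|exists p].
have [q qP] := choice qex.
have XP (x : twins F p) : pos (map_pair ei (q (val x))) \in X.
  by rewrite inE; exists (map_pair ei (q (val x))) => //; split; eexists.
apply: (@increasing_ole _ _ (fun x : otp (twins F p) => in_otp (XP x))).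
move=> x y xy; have [hx fx lx] := qP _ (set_mem (valP (x : twins F p))).
have [hy fy ly] := qP _ (set_mem (valP (y : twins F p))).
apply: posP; rewrite /= ?hx ?hy //.
  by move: fx fy; rewrite /F /= => -> ->.
by apply: (ei); rewrite lx ly.
Qed.

Lemma rainbow_image (k m : Ord) (f : pair2 k -> k) (e : m -> k) (ei : increasing e) (A : set m) :
  set_inj (pairs A) (f \o map_pair ei) -> rainbow f (e @` A).
Proof.
move=> fA p q /set_mem[[x Ax lx] [y Ay hy]] /set_mem[[x' Ax' lx'] [y' Ay' hy']] pq.
have xy : wlt x y by rewrite /wlt -(increasing_mono ei) lx hy; exact: lo_hi.
have xy' : wlt x' y' by rewrite /wlt -(increasing_mono ei) lx' hy'; exact: lo_hi.
have pE : p = map_pair ei (Pair2 xy) by apply: pair2_eq.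
have qE : q = map_pair ei (Pair2 xy') by apply: pair2_eq.
rewrite pE qE in pq *; congr map_pair; apply: fA => //; by rewrite inE.
Qed.

(** * Stationary subsets of the supremum of an increasing sequence *)

Lemma cf_limit (m : Ord) : olt omega (cf m) -> forall x : m, exists y, wlt x y.
Proof.
by move=> mcf x; have [y xy] := olt_cf_bounded (fun=> x) mcf; exists y; exact: xy 0.
Qed.

Section Stationary.
Variables (k m : Ord) (e : m -> k).
Hypotheses (ei : increasing e) (mcf : olt omega (cf m)).
Let delta := osup (range e).

Lemma stationary_sub (d S S' : set k) : S `<=` S' -> stationary d S -> stationary d S'.
Proof. by move=> SS' dS C /dS[x [/SS' ? ?]]; exists x. Qed.

Lemma osup_rangeE y : delta y <-> exists x, wlt y (e x).
Proof. by split=> [[_ [x _ <-] yx]|[x yx]]; [exists x|exists (e x); [exists x|]]. Qed.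

Lemma osup_range x : delta (e x).
Proof. by apply/osup_rangeE; have [y xy] := cf_limit mcf x; exists y; exact: ei. Qed.

Lemma osup_range_low y z : wlt y z -> delta z -> delta y.
Proof. by move=> yz /osup_rangeE[x zx]; apply/osup_rangeE; exists x; apply: wlt_trans zx. Qed.

(** The points of [delta] above a given one form a club. *)
Lemma stationary_unbounded (R : set m) (x : m) : stationary delta (e @` R) ->
  exists2 y, R y & wlt x y.
Proof.
move=> /(_ [set y | delta y /\ wlt (e x) y])[|_ [[y Ry <-] [_ xy]]]; last first.
  by exists y => //; rewrite /wlt -(increasing_mono ei).
split=> [y []//| |y dy [u uy] yE]; last first.
  split=> //; have : seg y u by []; rewrite -yE => -[c [[_ xc] cy] _].
  exact: wlt_trans xc cy.
rewrite eqEsubset; split=> [y [z [dz _] yz]|y /osup_rangeE[z yz]].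
  exact: osup_range_low dz.
have [t zt xt] : exists2 t : m, wle z t & wle x t.
  by case/orP: (wle_total x z) => ?; [exists z|exists x] => //; exact: wle_refl.
have [t' tt'] := cf_limit mcf t; exists (e t'); last first.
  by apply: wlt_trans yz _; apply: ei; apply: wle_wlt_trans tt'.
by split; [exact: osup_range|apply: ei; apply: wle_wlt_trans tt'].
Qed.

(** To find a common point of the clubs above a given one, alternate between them
    for [omega] steps, each step staying bounded because [cf m] exceeds the number
    of clubs, and take the supremum, which exists below [delta] because [cf m] is
    uncountable. *)
Lemma club_bigcap (g : Ord) (C : g -> set k) : olt g (cf m) -> inhabited g ->
  (forall i, club delta (C i)) -> club delta (\bigcap_(i in [set: g]) C i).
Proof.
move=> gcf [i0] Cc.
have Cup i x : exists y, exists c, [/\ C i c, wlt (e x) c & wlt c (e y)].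
  have [Cd Cs _] := Cc i; have := osup_range x; rewrite -Cs => -[c Cic xc].
  by have /osup_rangeE[y cy] := Cd _ Cic; exists y, c.
have nextex x : exists y, forall i, exists c, [/\ C i c, wlt (e x) c & wlt c (e y)].
  have [b bP] := choice (fun i => Cup i x); have [y yP] := olt_cf_bounded b gcf.
  exists y => i; have [c [Cc' xc cb]] := bP i; exists c; split=> //.
  by apply: wlt_trans cb _; exact: ei.
have [next nextP] := choice nextex.
have unb x0 : exists2 s, (\bigcap_(i in [set: g]) C i) s & wlt (e x0) s.
  pose z n := iter n next x0.
  have [x zx] := olt_cf_bounded (z : omega -> m) mcf.
  have [|s sz smin] := @wlt_wo_min k (fun s => forall n, wlt (e (z n)) s).
    by exists (e x) => n; exact: ei.
  exists s; last exact: sz 0.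
  move=> i _; have [_ _ Ccl] := Cc i; apply: Ccl.
  - have sx : wle s (e x).
      by rewrite -[wle _ _]negbK; apply/negP => /smin; apply => n; exact: ei.
    have /osup_rangeE[y xy] := osup_range x; apply/osup_rangeE; exists y.
    exact: wle_wlt_trans sx xy.
  - by exists (e (z 0)); exact: sz 0.
  - rewrite eqEsubset; split=> [y [c [_ cs] yc]|y ys]; first exact: wlt_trans yc cs.
    have [n nyz] : exists n, ~ wlt (e (z n)) y by apply/existsNP; exact: smin.
    have [c [Cic zc cz]] := nextP (z n) i; exists c.
      by split=> //; apply: wlt_trans cz (sz n.+1).
    by apply: wle_wlt_trans zc; rewrite -[wle _ _]negbK; apply/negP.
split=> [x Cx| |x dx sx xE i _].
- by have [Cd _ _] := Cc i0; exact: Cd (Cx i0 I).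
- rewrite eqEsubset; split=> [y [c Cx yc]|y /osup_rangeE[x yx]].
    by apply: osup_range_low yc _; have [Cd _ _] := Cc i0; exact: Cd (Cx i0 I).
  by have [s Cs xs] := unb x; exists s => //; exact: wlt_trans yx xs.
- have [_ _ Ccl] := Cc i; apply: Ccl => //; rewrite eqEsubset; split.
    by move=> y [c [_ cs] yc]; exact: wlt_trans yc cs.
  by rewrite -{1}xE => y [c [Cx cs] yc]; exists c => //; split=> //; exact: Cx i I.
Qed.

(** The clubs avoiding the various fibers would have a common point in the
    stationary set. *)
Lemma stationary_fiber (g : Ord) (R : set m) (h : m -> g) : olt g (cf m) ->
  stationary delta (e @` R) -> exists i, stationary delta (e @` (R `&` h @^-1` [set i])).
Proof.
move=> gcf Rs; apply: contrapT => /forallNP nS.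
have Cex i : exists C, club delta C /\ ~ ((e @` (R `&` h @^-1` [set i])) `&` C !=set0).
  by have /existsNP[C /not_implyP[? ?]] := nS i; exists C.
have [C CP] := choice Cex.
have [d _] := olt_increasing mcf; have [d' _] := ole_increasing (cf_ole m).
have gi : inhabited g := inhabits (h (d' (d 0))).
have [_ [[x Rx <-] Cx]] := Rs _ (club_bigcap gcf gi (fun i => (CP i).1)).
by apply: (CP (h x)).2; exists (e x); split; [exists x|exact: Cx].
Qed.

End Stationary.

Lemma cf_infinite (m : Ord) : olt omega (cf m) -> infinite_set [set: m].
Proof.
move=> mcf; apply/infiniteP; apply: card_le_trans (ole_card_le (cf_ole m)).
exact: olt_card_le mcf.
Qed.

(** * Free sets *)

(** The specification may leave several choices for the value at [x], as long as
    the allowed ones only depend on the earlier values. *)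
Lemma wo_recursion (a : Ord) (X : Type) (v0 : X) (P : a -> (a -> X) -> X -> Prop) :
  (forall x h, exists v, P x h v) ->
  (forall x h h' v, (forall y, wlt y x -> h y = h' y) -> P x h v -> P x h' v) ->
  exists s : a -> X, forall x, P x s (s x).
Proof.
move=> Pex Ploc.
have wf : well_founded (fun x y : a => wlt x y).
  move=> x; apply: contrapT => nx.
  have [|y ny ymin] := @wlt_wo_min a (fun y => ~ Acc (fun x y : a => wlt x y) y).
    by exists x.
  by apply: ny; constructor => z /ymin /contrapT.
have [c cP] := choice (fun xh : a * (a -> X) => Pex xh.1 xh.2).
pose ext (x : a) (rec : forall y, wlt y x -> X) (y : a) :=
  if pselect (wlt y x) is left yx then rec y yx else v0.
pose s := Fix wf (fun=> X) (fun x rec => c (x, ext x rec)).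
exists s => x; rewrite /s Fix_eq -/s => [|y f g fg]; last first.
  by congr (c (_, ext _ _)); apply: functional_extensionality_dep => z;
     apply: functional_extensionality_dep => yz.
apply: Ploc (cP (x, _)) => y yx; rewrite /= /ext.
by case: pselect.
Qed.

(** A set mapping [F] with small values of uniformly bounded size has, for
    singular [m], a free set of full size (Hajnal), stated here for pairs whose
    larger point carries the mapping.  The ground set is cut into [m] groups
    indexed by [T]; group after group, each label in [theta] is given to a point
    of the group not hit by earlier points with that label.  Within one group
    distinct labels sit on distinct points, so a point blocks at most [#|E|]
    labels.  If every label class were small, the
    cofinal small set [D] would bound the sizes of more than [#|E|] classes
    simultaneously, and a group outside all of them would contradict this. *)
Lemma free_set (m : Ord) (D : set m) U (E : set U) (F : m -> set m) :
  is_cardinal m -> infinite_set [set: m] ->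
  small m D -> (forall x, exists2 d, D d & wle x d) ->
  small m E -> (forall x, F x #<= E) ->
  exists2 B : set m, ~~ small m B &
    forall x y, B x -> B y -> wlt y x -> ~ F x y.
Proof.
move=> mc mi sD Dcof sE FE.
(* since [D] is small and cofinal, no size below [m] bounds all the others *)
have bigger V (S : set V) : small m S -> exists x : m, ~ (upto x #<= S).
  move=> sS; apply: contrapT => /forallNP nx.
  have /small_compl[x] : small m (\bigcup_(d in D) upto d).
    by apply: (small_bigcup mc mi sD sS) => d _; exact: contrapT (nx d).
  by apply; have [d Dd xd] := Dcof x; exists d.
(* more labels than [D] times [E], and then groups larger than the set of labels *)
have [a aDE] := bigger _ _ (small_setX mc mi sD sE).
pose theta := otp (upto a).
have stheta : small m [set: theta] := small_le (upto_small mc mi a) (otp_card_le _).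
have [b bt] := bigger _ _ stheta.
pose T := otp (upto b).
have sT : small m [set: T] := small_le (upto_small mc mi b) (otp_card_le _).
have T0 : [set: T] !=set0.
  by exists (in_otp (mem_set (wle_refl b : upto b b))).
have [el eli els] := oiso_increasing (lex_oiso mc mi sT T0).
have elI := increasing_inj eli.
pose ok (p : lexO m theta) (h : lexO m theta -> option T) (t : T) :=
  (forall z, wlt z p.2 -> h (p.1, z) <> Some t) /\
  (forall x s, wlt x p.1 -> h (x, p.2) = Some s -> ~ F (el (p.1, t)) (el (x, s))).
have [||lab labP] := @wo_recursion (lexO m theta) (option T) None
    (fun p h v => if v is Some t then ok p h t else forall t, ~ ok p h t).
- move=> p h; have [[t pt]|/forallNP np] := pselect (exists t, ok p h t); last by exists None.
  by exists (Some t).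
- have okloc p h h' t : (forall q, wlt q p -> h q = h' q) -> ok p h t -> ok p h' t.
    move=> hh [ok1 ok2]; split=> [z zp|x s xp].
      by rewrite -hh; [exact: ok1|apply/lex_wlt; right].
    by rewrite -hh; [exact: ok2|apply/lex_wlt; left].
  move=> p h h' [t|] hh; first exact: okloc.
  by move=> nok t hok; apply: (nok t); apply: okloc hok => q /hh.
have labS p t : lab p = Some t -> ok p lab t by move=> pt; have := labP p; rewrite pt.
have labN p t : lab p = None -> ~ ok p lab t by move=> pt; have := labP p; rewrite pt; exact.
have labI x z z' t : lab (x, z) = Some t -> lab (x, z') = Some t -> z = z'.
  move=> zt z't; have [zz'|//|z'z] := wlt_total z z'.
    by have [ok1 _] := labS _ _ z't; case: (ok1 _ zz').
  by have [ok1 _] := labS _ _ zt; case: (ok1 _ z'z).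
pose B z := [set y | exists x t, lab (x, z) = Some t /\ y = el (x, t)].
have Bfree z x y : B z x -> B z y -> wlt y x -> ~ F x y.
  move=> [g [t [gt ->]]] [g' [t' [gt' ->]]] lt.
  have : wlt ((g', t') : lexO m T) (g, t) by rewrite /wlt -(increasing_mono eli).
  move=> /lex_wlt /= [gg|[gg tt]]; last first.
    by move: tt; rewrite gg gt in gt' *; case: gt' => ->; rewrite wltxx.
  by have [_] := labS _ _ gt; apply.
apply: contrapT => nB.
have sB z : small m (B z).
  by rewrite -[small _ _]negbK; apply/negP => bB; apply: nB; exists (B z) => //; exact: Bfree.
pose G z := [set x | lab (x, z) <> None].
have GB z : G z #<= B z.
  pose f x := if lab (x, z) is Some t then el (x, t) else x.
  apply: (@card_leI _ _ _ _ f) => [x|x y]; rewrite /G /f /=.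
    by case xz: (lab _) => [t|//] _; exists x, t.
  by case: (lab _) => [t|//] _; case: (lab _) => [s|//] _ /elI [].
have dex z : exists d, D d /\ G z #<= upto d.
  have [x Bx] := small_le_seg (sB z); have [d Dd xd] := Dcof x; exists d; split=> //.
  apply: card_le_trans (GB z) _; apply: card_le_trans Bx _; apply: subset_card_le.
  by move=> y /= yx; apply: wle_trans xd; exact: wltW.
have [dd ddP] := choice dex.
have [d Dd dE] : exists2 d, D d & ~ (dd @^-1` [set d] #<= E).
  apply: contrapT => nd; apply: aDE.
  apply: card_le_trans (card_le_otp _) _.
  have -> : [set: otp (upto a)] = \bigcup_(d in D) (dd @^-1` [set d]).
    by rewrite eqEsubset; split=> // z _; exists (dd z) => //; exact: (ddP z).1.
  apply: card_bigcup_le => d Dd; apply: contrapT => ndE; apply: nd; by exists d.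
have [x Gx] : exists x, ~ (\bigcup_(z in dd @^-1` [set d]) G z) x.
  apply: small_compl.
  apply: (small_bigcup mc mi _ (upto_small mc mi d)) => [|z <-]; last exact: (ddP z).2.
  exact: small_le stheta (card_leT _).
have xN z : dd z = d -> lab (x, z) = None.
  by move=> zd; apply: contrapT => nx; apply: Gx; exists z.
(* labels are injective within the group, so they leave a point unlabelled *)
have [t tfree] : exists t : T, forall z, lab (x, z) <> Some t.
  apply: contrapT => nt; apply: bt; apply: card_le_trans (card_le_otp _) _.
  have zex (t : T) : exists z, lab (x, z) = Some t.
    by apply: contrapT => /forallNP nz; apply: nt; exists t.
  have [f fP] := choice zex; apply: (@card_leI _ _ _ _ f) => // s t _ _ st.
  by have := fP s; rewrite st fP => -[].
apply: dE; apply: card_le_trans (FE (el (x, t))).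
have hit z : exists y, dd z = d -> exists x' s, [/\ lab (x', z) = Some s, y = el (x', s)
    & F (el (x, t)) y].
  have [zd|nzd] := pselect (dd z = d); last by exists x.
  have /(_ t) := labN _ _ (xN _ zd) => /not_andP[[]|]; first by move=> z' _; exact: tfree.
  move=> /existsNP[x' /existsNP[s /not_implyP[_ /not_implyP[xs /contrapT Fx]]]].
  by exists (el (x', s)) => _; exists x', s.
have [f fP] := choice hit.
apply: (@card_leI _ _ _ _ f) => [z /fP[x' [s []]] //|z z' /fP[y [s [ys -> _]]]].
move=> /fP[y' [s' [ys' -> _]]] /elI [yy ss].
by rewrite -yy -ss in ys'; exact: labI ys ys'.
Qed.

(** * Many colorings that are injective on one positive set *)

(** [c] is a family of [m] colorings of a set [d] of size less than [m], and
    [Pos] behaves like the positive sets of a [cf m]-complete ideal on [d].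
    Suppose every positive [Y] is mapped injectively by few of the [c b] only.
    Stack [m] copies of [d] and let the point [(y, z)] see every earlier copy
    through its own coloring [c (b (y, z))]; this is a normal coloring [F] with
    the same bound on its classes.  In a partition of the copies into fewer than
    [cf m] rainbow pieces, choose for each piece [n] that is positive on some copy
    one such copy [xs n].  The few exceptional colorings for all these choices are
    still few together, so a later copy [y] avoids them.  Then no point of copy
    [y] lies in a piece [n] of that kind, since it would see two points of
    copy [xs n] in the same piece with the same color; but some piece is positive
    on copy [y]. *)
Lemma positive_many_injective (m r d : Ord) (L : Type) (c : m -> d -> L) (Pos : set d -> Prop) :
  is_cardinal m -> infinite_set [set: m] -> small m [set: d] -> [set: d] !=set0 ->
  poly_par m r ->
  (exists2 g, olt g r & forall b x, ole (otp [set y | c b y = c b x]) g) ->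
  (forall (g : Ord) (h : d -> g), olt g (cf m) -> exists i, Pos (h @^-1` [set i])) ->
  (forall Y, Pos Y -> Y !=set0) ->
  exists2 Y, Pos Y & ~~ small m [set b | {in Y &, injective (c b)}].
Proof.
move=> mc mi sd d0 mr [g0 g0r cg0] Pfib Pn0.
have Vm := lex_oiso mc mi sd d0; pose V := lexO m d.
have [b bi _] := oiso_increasing Vm; have bI := increasing_inj bi.
pose F (p : pair2 V) : V * (m * L + V) :=
  (hi p, if wlt (lo p).1 (hi p).1 then inl ((lo p).1, c (b (hi p)) (lo p).2) else inr (lo p)).
have Fn : normal_on F by move=> p q [].
have Fb : classes_bounded r F.
  exists g0 => // p; apply: ole_trans (cg0 (b (hi p)) (lo p).2).
  have twP (u : twins F p) :
      (val u).2 \in [set y | c (b (hi p)) y = c (b (hi p)) (lo p).2].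
    case: u => u /= /set_mem[q [hq Fq] <-]; rewrite inE /=.
    by move: Fq; rewrite /F hq => -[]; case: ifP => _; case: ifP => _ //; [case|case=> ->].
  apply: (@increasing_ole _ _ (fun u : otp (twins F p) => in_otp (twP u))).
  move=> [u uP] [v vP] /= uv; have {uv} uv : wlt u v by exact: uv.
  change (is_true (wlt u.2 v.2)); move: uv.
  have [q [hq Fq] qu] := set_mem uP; have [s [hs Fs] sv] := set_mem vP.
  have : F q = F s by rewrite Fq.
  rewrite /F hq hs qu sv => -[]; case: ifP => _; case: ifP => _ //; last first.
    by move=> [uv] /[1!uv]; rewrite wltxx.
  by move=> [uv1 _] /lex_wlt[|[]//]; rewrite uv1 wltxx.
have [g gcf [h hP]] := poly_par_recolor mi mr Vm Fn Fb.
pose S x n : set d := [set z | h (x, z) = n].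
have [x0 _] := infinite_setN0 mi.
have xex n : exists x, (exists x', Pos (S x' n)) -> Pos (S x n).
  by have [[x Px]|nx] := pselect (exists x', Pos (S x' n)); [exists x|exists x0].
have [xs xsP] := choice xex.
apply: contrapT => nY.
pose E (Y : set d) := [set a | {in Y &, injective (c a)}].
have sE Y : Pos Y -> small m (E Y).
  by move=> PY; rewrite -[small _ _]negbK; apply/negP => bY; apply: nY; exists Y.
(* copies [y] that contain an exceptional coloring for piece [n], or are not
   later than [xs n] *)
pose bad n := [set y | Pos (S (xs n) n) /\ exists z, E (S (xs n) n) (b (y, z))] `|` upto (xs n).
have [y ybad] : exists y, ~ (\bigcup_(n in [set: g]) bad n) y.
  apply: small_compl; apply: (small_bigcup_cf mc mi gcf) => n.
  apply: (small_setU mc mi) (upto_small mc mi _).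
  have [PS|nPS] := pselect (Pos (S (xs n) n)); last first.
    by apply: (finite_small mi); rewrite (_ : [set _ | _] = set0) // eqEsubset; split=> // y [].
  apply: (small_le (sE _ PS)).
  have [z0 _] := d0.
  have zex y : exists z, (exists z', E (S (xs n) n) (b (y, z'))) -> E (S (xs n) n) (b (y, z)).
    by have [[z Ez]|nz] := pselect (exists z', E (S (xs n) n) (b (y, z'))); [exists z|exists z0].
  have [z zP] := choice zex.
  by apply: (@card_leI _ _ _ _ (fun y => b (y, z y))) => [y [_ /zP] //|y y' _ _ /bI[]].
have [n Pn] := Pfib g (fun z => h (y, z)) gcf.
have [z zn] := Pn0 _ Pn.
have PS : Pos (S (xs n) n) by apply: xsP; exists y.
apply: ybad; exists n => //.
have [xy|xy] := boolP (wle y (xs n)); [by right|left; split=> //; exists z].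
have low u : wlt ((xs n, u) : V) (y, z) by apply/lex_wlt; left.
move=> u v /set_mem un /set_mem vn cuv.
have : Pair2 (low u) = Pair2 (low v).
  apply: (hP n); [by rewrite inE; split|by rewrite inE; split|].
  by rewrite /F /= (xy : wlt (xs n) y) cuv.
by case.
Qed.

(** * A rainbow set that is positive and of full size *)

(** Otherwise the coloring of a pair by its maximum would be type bounded; its
    rainbow sets have at most two elements, and fewer than [cf m] of them cannot
    cover [m]. *)
Lemma poly_par_bound_small (m r g : Ord) : is_cardinal m -> olt omega (cf m) ->
  poly_par m r -> olt g r -> small m [set: g].
Proof.
move=> mc mcf mr gr; have mi := cf_infinite mcf.
rewrite /small; apply/negP => mg.
have mg' : ole m g.
  by have [//|/(olt_small mc)/negP[]] := ole_total m g.
have [||d dcf [h hP]] := mr (@hi m); first by [].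
  exists g => // p; apply: ole_trans mg'; exact: increasing_ole (@otp_val_increasing _ _).
have /negP[] := not_smallT m.
have -> : [set: m] = \bigcup_(i in [set: d]) (h @^-1` [set i]).
  by rewrite eqEsubset; split=> // x _; exists (h x).
apply: (small_bigcup_cf mc mi dcf) => i; rewrite -[small _ _]negbK; apply/negP.
move=> /(big_otp mc)/otp_enum[e ei eR].
have [a ai] := olt_increasing mcf; have [b bi] := ole_increasing (cf_ole m).
pose x n := e (b (a n)).
have xi n n' : (n < n')%N -> wlt (x n) (x n').
  by move=> nn; apply/ei/bi/ai; rewrite /wlt /= -ltnNge.
have xF n : (h @^-1` [set i]) (x n) by rewrite -eR; exists (b (a n)).
have : Pair2 (xi 0 2 isT) = Pair2 (xi 1 2 isT).
  by apply: (hP i); rewrite ?inE //; split; exact: xF.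
by case=> /(increasing_inj ei)/(increasing_inj bi)/(increasing_inj ai).
Qed.

Section Conflict.
Variables (m : Ord) (L : Type) (F : pair2 m -> L).

Definition conflict (x y z : m) : Prop :=
  exists p q, [/\ lo p = x, lo q = y, hi p = z, hi q = z & F p = F q].

Lemma conflict_sym x y z : conflict x y z -> conflict y x z.
Proof. by move=> [p [q [? ? ? ? ?]]]; exists q, p. Qed.

Lemma conflict_wlt x y z : conflict x y z -> wlt x z.
Proof. by move=> [p [q [<- _ <- _ _]]]; exact: lo_hi. Qed.

Lemma rainbow_conflict (A : set m) x y z : set_inj (pairs A) F ->
  A x -> A y -> A z -> conflict x y z -> x = y.
Proof.
move=> FA Ax Ay Az [p [q [px qy pz qz pq]]].
by rewrite -px -qy (FA p q _ _ pq) //; rewrite inE; split; rewrite ?px ?qy ?pz ?qz.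
Qed.

Lemma conflict_rainbow (A : set m) : normal_on F ->
  (forall x y z, A x -> A y -> A z -> conflict x y z -> x = y) -> set_inj (pairs A) F.
Proof.
move=> Fn AF p q /set_mem[Alp Ahp] /set_mem[Alq Ahq] pq; have hpq := Fn _ _ pq.
by apply: pair2_eq => //; apply: AF Alp Alq Ahp _; exists p, q.
Qed.

Lemma conflict_card (g : Ord) y z : (forall p, ole (otp (twins F p)) g) ->
  [set x | conflict x y z] #<= [set: g].
Proof.
move=> Fg; have [[x [p [q [px qy pz qz pq]]]]|nx] := pselect (exists x, conflict x y z).
  apply: card_le_trans (ole_card_le (Fg q)); apply: card_le_trans (card_le_otp _).
  apply: subset_card_le => x' [p' [q' [px' qy' pz' qz' pq']]].
  have -> : q = q' by apply: pair2_eq; [rewrite qy qy'|rewrite qz qz'].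
  by exists p' => //; split; rewrite ?pz' ?qz'.
rewrite (_ : [set _ | _] = set0); first exact: card_ge0.
by rewrite eqEsubset; split=> // x xyz; apply: nx; exists x.
Qed.

End Conflict.

(** A single application of the partition relation gives a positive rainbow piece
    [D] and a rainbow piece of full size, which may differ: a stationary set can
    have smaller order type than [m] when [m] is singular.  If [D] is small, it
    witnesses that [m] is singular, and the two pieces have to be merged.  The
    large piece is thinned so that the only conflicts left in its union with [D]
    are those between two points of [D] below a point of the large piece: those
    with top and one lower point in [D] are avoided by discarding [bad], and those
    with two points of the large piece by passing to a free set.  The remaining
    ones are removed by shrinking [D] to a positive [Y] on which full-size many of
    the colorings induced by the points of the large piece are injective. *)
Lemma positive_rainbow (m r : Ord) (L : Type) (F : pair2 m -> L) (Pos : set m -> Prop) :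
  is_cardinal m -> olt omega (cf m) -> poly_par m r -> normal_on F -> classes_bounded r F ->
  Pos [set: m] -> (forall R S, R `<=` S -> Pos R -> Pos S) ->
  (forall R x, Pos R -> exists2 y, R y & wlt x y) ->
  (forall (g : Ord) R (h : m -> g), olt g (cf m) -> Pos R ->
    exists i, Pos (R `&` h @^-1` [set i])) ->
  exists Z, [/\ Pos Z, ~~ small m Z & set_inj (pairs Z) F].
Proof.
move=> mc mcf mr Fn Fb PT Psub Punb Pfib; have mi := cf_infinite mcf.
have [g gcf [h hP]] := poly_par_recolor mi mr (oiso_refl m) Fn Fb.
have [i] := Pfib g _ h gcf PT; rewrite setTI; set D := h @^-1` [set i] => PD.
have [sD|bD] := boolP (small m D); last by exists D; split=> //; exact: hP.
have [j bj] : exists j, ~~ small m (h @^-1` [set j]).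
  apply: contrapT => /forallNP nj; have /negP[] := not_smallT m.
  have -> : [set: m] = \bigcup_(j in [set: g]) (h @^-1` [set j]).
    by rewrite eqEsubset; split=> // x _; exists (h x).
  by apply: (small_bigcup_cf mc mi gcf) => j; rewrite -[small _ _]negbK; exact/negP.
have [g0 g0r Fg0] := Fb; have sg0 := poly_par_bound_small mc mcf mr g0r.
pose bad := \bigcup_(p in D `*` D) [set x | conflict F x p.1 p.2].
have sbad : small m bad.
  apply: (small_bigcup mc mi _ sg0) => [|p _]; first exact: small_setX.
  exact: conflict_card.
pose B0 := h @^-1` [set j] `\` bad.
have bB0 : ~~ small m B0.
  apply: contra bj => sB0; apply: (small_le (small_setU mc mi sB0 sbad)).
  by apply: subset_card_le => x xj; have [?|?] := pselect (bad x); [right|left].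
have [e0 e0i e0R] := otp_enum (big_otp mc bB0); have e0I := increasing_inj e0i.
pose hit b := \bigcup_(x in D) ([set y | conflict F (e0 y) x (e0 b)] `|`
                               [set y | conflict F (e0 y) (e0 b) x]).
have hitE b : hit b #<= D `*` ([set: bool] `*` [set: g0]).
  apply: card_bigcup_le => x _; apply: card_setU_le.
    apply: card_le_trans (conflict_card x (e0 b) Fg0).
    by apply: (@card_leI _ _ _ _ e0) => // y y' _ _ /e0I.
  apply: card_le_trans (conflict_card (e0 b) x Fg0).
  by apply: (@card_leI _ _ _ _ e0) => // y y' _ _ /e0I.
have sE : small m (D `*` ([set: bool] `*` [set: g0])).
  apply: (small_setX mc mi sD); apply: (small_setX mc mi _ sg0).
  by apply: (finite_small mi); exact: finite_finset.
have Dcof x : exists2 y, D y & wle x y by have [y Dy /wltW xy] := Punb D x PD; exists y.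
have [B1 bB1 B1free] := free_set mc mi sD Dcof sE hitE.
have [e1 e1i e1R] := otp_enum (big_otp mc bB1).
pose e := e0 \o e1; have ei : increasing e := increasing_comp e1i e0i.
have eI := increasing_inj ei.
have eB0 b : B0 (e b) by rewrite -e0R; exists (e1 b).
have free b b' x : D x -> wlt b' b ->
    ~ (conflict F (e b') x (e b) \/ conflict F (e b') (e b) x).
  move=> Dx bb Fx; apply: (B1free (e1 b) (e1 b')); first by rewrite -e1R; exists b.
  - by rewrite -e1R; exists b'.
  - exact: e1i.
  - by exists x.
(* points of [D] that are not below [e b] get private colors *)
pose c b (x : otp D) : L + m :=
  if pselect (wlt (val (x : D)) (e b)) is left lt then inl (F (Pair2 lt)) else inr (val (x : D)).
have cE b (x : otp D) (lt : wlt (val (x : D)) (e b)) : c b x = inl (F (Pair2 lt)).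
  by rewrite /c; case: pselect => // lt'; rewrite (bool_irrelevance lt' lt).
have cN b (x : otp D) : ~ wlt (val (x : D)) (e b) -> c b x = inr (val (x : D)).
  by rewrite /c; case: pselect.
have conflict_c b (x y : otp D) :
    conflict F (val (x : D)) (val (y : D)) (e b) -> c b x = c b y.
  move=> [p [q [px qy pz qz pq]]].
  have xb : wlt (val (x : D)) (e b) by rewrite -px -pz; exact: lo_hi.
  have yb : wlt (val (y : D)) (e b) by rewrite -qy -qz; exact: lo_hi.
  rewrite (cE _ _ xb) (cE _ _ yb); congr (inl _).
  have -> : Pair2 xb = p by apply: pair2_eq.
  by rewrite pq; congr F; apply: pair2_eq.
have cb : exists2 g, olt g r & forall b x, ole (otp [set y | c b y = c b x]) g.
  exists g0 => // b x; have [xb|nxb] := pselect (wlt (val (x : D)) (e b)).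
    apply: ole_trans (Fg0 (Pair2 xb)).
    have twP (y : [set y | c b y = c b x]) :
        val (val y : D) \in twins F (Pair2 xb).
      case: y => y /= /set_mem /=; rewrite (cE _ _ xb) inE.
      have [yb|nyb] := pselect (wlt (val (y : D)) (e b)); last by rewrite cN.
      by rewrite (cE _ _ yb) => -[yx]; exists (Pair2 yb).
    apply: (@increasing_ole _ _
      (fun y : otp [set y | c b y = c b x] => in_otp (twP y))).
    by move=> y z.
  (* the class is the singleton of [x]; any class shows that [g0] is nonempty *)
  have [z xz] := cf_limit mcf (val (x : D)).
  have [a _] := ole_increasing (Fg0 (Pair2 xz)).
  have xtw : val (x : D) \in twins F (Pair2 xz) by rewrite inE; exists (Pair2 xz).
  have cx (y : [set y | c b y = c b x]) : val y = x.
    case: y => y /= /set_mem /=; rewrite (cN _ _ nxb).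
    have [yb|nyb] := pselect (wlt (val (y : D)) (e b)); first by rewrite (cE _ _ yb).
    by rewrite cN // => -[]; exact: val_inj.
  apply: (@increasing_ole (otp [set y | c b y = c b x]) _ (fun=> a (in_otp xtw))) => y y'.
  by rewrite {1}/wlt /= !cx wle_refl.
pose Pos' (Y : set (otp D)) := Pos [set val (x : D) | x in Y].
have [||||Y PY bY] := @positive_many_injective m r (otp D) _ c Pos' mc mi _ _ mr cb.
- exact: small_le sD (otp_card_le _).
- have [x0 _] := infinite_setN0 mi; have [x Dx _] := Punb D x0 PD.
  by exists (in_otp (mem_set Dx)).
- move=> d k dcf; have [x0 _] := infinite_setN0 mi; have [x Dx _] := Punb D x0 PD.
  pose k' y := if pselect (D y) is left Dy then k (in_otp (mem_set Dy))
               else k (in_otp (mem_set Dx)).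
  have [n Pn] := Pfib d D k' dcf PD; exists n; apply: Psub Pn => y [Dy].
  rewrite /= /k'; case: pselect => // Dy' kn.
  by exists (in_otp (mem_set Dy')).
- by move=> Y PY; have [x0 _] := infinite_setN0 mi; have [_ [x Yx _] _] := Punb _ x0 PY; exists x.
set B2 := [set b | _] in bY.
exists ([set val (x : D) | x in Y] `|` e @` B2); split.
- by apply: Psub PY => x; left.
- apply: contra bY => sZ; apply: (small_le sZ).
  by apply: (@card_leI _ _ _ _ e) => [b Bb|b b' _ _ /eI //]; right; exists b.
have YD x : [set val (x : D) | x in Y] x -> D x.
  by move=> [u _ <-]; exact: set_mem (valP (u : D)).
have BB x : (e @` B2) x -> B0 x by move=> [b _ <-].
have BBD x y z : B0 x -> D y -> D z -> ~ conflict F x y z.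
  by move=> [_ nx] Dy Dz xyz; apply: nx; exists (y, z).
have BDB x y z : (e @` B2) x -> D y -> (e @` B2) z -> ~ conflict F x y z.
  move=> [b _ <-] Dy [b' _ <-] xyz; apply: (free b' b y Dy); last by left.
  by rewrite /wlt -(increasing_mono ei); exact: conflict_wlt xyz.
have BBY x y z : (e @` B2) x -> (e @` B2) y -> D z -> conflict F x y z -> x = y.
  move=> [b _ <-] [b' _ <-] Dz xyz; have [bb|-> //|bb] := wlt_total b b'.
    by case: (free b' b z Dz bb); right.
  by case: (free b b' z Dz bb); right; exact: conflict_sym.
apply: conflict_rainbow => // x y z [Yx|Bx] [Yy|By] [Yz|Bz] xyz.
- exact: rainbow_conflict (hP i) (YD _ Yx) (YD _ Yy) (YD _ Yz) xyz.
- move: Yx Yy Bz xyz => [u Yu <-] [v Yv <-] [b B2b <-] /conflict_c uv.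
  by rewrite (B2b u v) // inE.
- by case: (BBD y x z (BB _ By) (YD _ Yx) (YD _ Yz)); exact: conflict_sym.
- by case: (BDB y x z By (YD _ Yx) Bz); exact: conflict_sym.
- by case: (BBD x y z (BB _ Bx) (YD _ Yy) (YD _ Yz)).
- by case: (BDB x y z Bx (YD _ Yy) Bz).
- exact: BBY Bx By (YD _ Yz) xyz.
- exact: rainbow_conflict (hP j) (BB _ Bx).1 (BB _ By).1 (BB _ Bz).1 xyz.
Qed.

Theorem proposition3p5 (kappa lambda mu rho theta : Ord)
  (card_kappa : is_cardinal kappa) (card_lambda : is_cardinal lambda)
  (card_mu : is_cardinal mu) (card_rho : is_cardinal rho)
  (card_theta : is_cardinal theta)
  (cf_mu : olt omega (cf mu)) :
  (arrow kappa mu lambda rho -> poly mu theta rho ->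
     poly kappa theta (succ_card lambda))
  /\
  (arrow_st kappa mu lambda rho -> poly_par mu rho ->
     poly_st kappa mu (succ_card lambda)).
Proof.
split=> [ar mtr|ar mr] f fn fb; have [c cP] := thin_bounded rho fn fb.
  have [A /otp_enum[e ei eA] cA] := ar c; rewrite -eA in cA.
  have [Fn Fb] := cP _ _ ei cA.
  have [B Bt FB] := poly_recolor (cf_infinite cf_mu) mtr Fn Fb.
  exists (e @` B); last exact: rainbow_image FB.
  exact: oiso_trans (otp_image B ei) Bt.
have [A [/otp_enum[e ei eA] sA cA]] := ar c; rewrite -eA in sA cA.
have [Fn Fb] := cP _ _ ei cA.
have [||||Z [PZ bZ FZ]] := @positive_rainbow mu rho _ _
  (fun R => stationary (osup (range e)) (e @` R)) card_mu cf_mu mr Fn Fb.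
- exact: sA.
- by move=> R S RS; apply: stationary_sub; exact: image_subset.
- by move=> R x; exact: stationary_unbounded.
- by move=> g R h gcf; exact: stationary_fiber.
exists (e @` Z); split; last exact: rainbow_image FZ.
  exact: oiso_trans (otp_image Z ei) (big_otp card_mu bZ).
suff -> : osup (e @` Z) = osup (range e) by [].
rewrite eqEsubset; split=> [y [_ [x _ <-] yx]|y [_ [x _ <-] yx]]; first by exists (e x).
have [z Zz xz] := stationary_unbounded ei cf_mu x PZ.
by exists (e z); [exists z|apply: wlt_trans yx _; exact: (ei _ _ xz)].
Qed.
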